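(* Let $V$, $f$, $\mathcal Q^+(7,2)$, $G^*$, $\mathcal X$, $\mathrm{Inv}_1$ and $\mathrm{Inv}_2$ be as in the context. Let $R_0$ be the identity relation on $\mathcal X$, and for distinct $\mathcal S,\mathcal T\in\mathcal X$ put - $(\mathcal S,\mathcal T)\in R_1$ iff $\mathrm{Inv}_1(\mathcal S,\mathcal T)=2$ and $\mathrm{Inv}_2(\mathcal S,\mathcal T)=0$; - $(\mathcal S,\mathcal T)\in R_2$ iff $\mathrm{Inv}_1(\mathcal S,\mathcal T)=-2$ and $\mathrm{Inv}_2(\mathcal S,\mathcal T)=0$; - $(\mathcal S,\mathcal T)\in R_3$ iff $\mathrm{Inv}_1(\mathcal S,\mathcal T)=-2$ and $\mathrm{Inv}_2(\mathcal S,\mathcal T)=2$; - $(\mathcal S,\mathcal T)\in R_4$ iff $\mathrm{Inv}_1(\mathcal S,\mathcal T)=2$ and $\mathrm{Inv}_2(\mathcal S,\mathcal T)=2$; - $(\mathcal S,\mathcal T)\in R_5$ iff $\mathrm{Inv}_1(\mathcal S,\mathcal T)=0$ and $\mathrm{Inv}_2(\mathcal S,\mathcal T)=1$; - $(\mathcal S,\mathcal T)\in R_6$ iff $\mathrm{Inv}_1(\mathcal S,\mathcal T)=0$ and $\mathrm{Inv}_2(\mathcal S,\mathcal T)=3$. Then $R_0,\dots,R_6$ are exactly the orbitals of the generously transitive action of $G^*$ on $\mathcal X$, and they form a $6$-class symmetric association scheme. Up to the ordering of its rows, its matrix of eigenvalues is $$\boldsymbol P=\begin{pmatrix} 1 &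 7 & 14 & 21 & 21 & 42 & 14\\ 1 & 2 & 4 & -9 & 6 & -3 & -1\\ 1 & -1 & -2 & 3 & 3 & -6 & 2\\ 1 & -4 & -2 & -3 & 0 & 9 & -1\\ 1 & 3 & -2 & 3 & -1 & 2 & -6\\ 1 & -2 & 8 & 3 & -6 & -3 & -1\\ 1 & 3 & -2 & -3 & -7 & 2 & 6 \end{pmatrix}.$$ There are exactly two unions of the relations $R_1,\dots,R_6$ that are the adjacency relation of a strongly regular graph with parameters $(120,56,28,24)$, namely $R_5\cup R_6$ and $R_3\cup R_4\cup R_6$, for which $$\boldsymbol P(0,0,0,0,0,1,1)^\top=(56,-4,-4,8,-4,-4,8)^\top,\qquad \boldsymbol P(0,0,0,1,1,0,1)^\top=(56,-4,8,-4,-4,-4,-4)^\top.$$ The graph on $\mathcal X$ with adjacency relation $R_5\cup R_6$ is isomorphic to $\overline{\mathrm{NO}^+(8,2)}$. The graph $\Gamma^*$ on $\mathcal X$ with adjacency relation $R_3\cup R_4\cup R_6$ has $G^*$ (acting on $\mathcal X$) as its full automorphism group.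
   Context: Let $V=\{(x_1,\dots,x_9)\in\mathbb F_2^9 : x_1+\dots+x_9=0\}\cong\mathbb F_2^8$ and $f(X)=\sum_{1\le i<j\le 9}X_iX_j$. The points of $\mathrm{PG}(7,2)=\mathrm{PG}(V)$ on which $f$ vanishes (isotropic points) form the hyperbolic quadric $\mathcal Q^+(7,2)$; points where $f\ne0$ are anisotropic. A generator is a maximal totally isotropic subspace; it has projective dimension $3$. The generators split into two systems: $\pi$ and $\rho$ are in the same system iff $\dim(\pi\cap\rho)$ is odd. Dimensions are projective, with $\dim\varnothing=-1$. A spread is a set of pairwise disjoint generators partitioning the points of $\mathcal Q^+(7,2)$; it has $9$ elements, all in the same system. Let $Q_i$ ($1\le i\le 9$) be the point of $\mathcal Q^+(7,2)$ whose coordinate vector has a single $0$, in position $i$. The alternating group $\mathrm{Alt}_9$ acts on $V$ by coordinate permutation, preserving $f$ and both systems of generators. Let $G^*\cong\mathrm{Sym}_7$ be the subgroup of $\mathrm{Alt}_9$ stabilising the set $\{1,2\}$ of coordinates. For each of the two systems of generators, $G^*$ has exactly two orbits, of sizes $120$ and $840$, on the spreads consisting of generators in that system. Let $\mathcal X$ be such an orbit of size $120$. For a spread $\mathcal S$, let $\mathcal S_i$ be the unique element of $\mathcal S$ containing $Q_i$, so $\mathcal S=\{\mathcal S_1,\dots,\mathcal S_9\}$. For $\mathcal S,\mathcal T\in\mathcal X$ let $\mathrm{Inv}_1(\mathcal S,\mathcal T)=\dim(\mathcal S_1\cap\mathcal T_2)+\dim(\mathcal S_2\cap\mathcal T_1)$,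 and let $\mathrm{Inv}_2(\mathcal S,\mathcal T)$ be the number of generators in $\{\mathcal T_3,\dots,\mathcal T_9\}$ that intersect both $\mathcal S_1$ and $\mathcal S_2$ in a line. An action of a group on $\mathcal X$ is generously transitive if for all $x,y\in\mathcal X$ some group element swaps $x$ and $y$ (maps $x$ to $y$ and $y$ to $x$). Orbitals are the orbits on $\mathcal X^2$. A $d$-class symmetric association scheme on $\mathcal X$ is a list of relations $(R_0,\dots,R_d)$ on $\mathcal X$ whose $0/1$ adjacency matrices $A_0,\dots,A_d$ are symmetric, satisfy $A_0=I$ and $\sum_i A_i=J$ (all-one matrix), and span a commutative matrix algebra. Then $\mathbb R^{\mathcal X}$ decomposes orthogonally into common eigenspaces $W_0,\dots,W_d$ with $W_0$ spanned by the all-one vector, such that every eigenspace of every $A_i$ is a sum of some of the $W_j$; the matrix of eigenvalues $\boldsymbol P$ has $\boldsymbol P(j,i)$ equal to the eigenvalue of $A_i$ on $W_j$ (rows $1,\dots,d$ are determined up to permutation). A graph is strongly regular with parameters $(n,k,\lambda,\mu)$ if it has $n$ vertices, is $k$-regular, and two distinct vertices have $\lambda$ common neighbours if adjacent and $\mu$ otherwise. $\overline{\mathrm{NO}^+(8,2)}$ is the graph whose vertices are the $120$ anisotropic points of $\mathrm{PG}(7,2)$ with respect to $f$, two vertices being adjacent iff they are not orthogonal for the alternating form $B(X,Y)=f(X+Y)-f(X)-f(Y)$. *)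

(* Defs.v *)
From HB Require Import structures.
From mathcomp Require Import all_boot all_order all_algebra.
From mathcomp Require Import all_fingroup all_solvable.

Set Implicit Arguments.
Unset Strict Implicit.
Unset Printing Implicit Defensive.

Import Order.TTheory GRing.Theory Num.Theory.

Local Open Scope ring_scope.

(* Relations on [X : {set T}] are sets of pairs; the rows and columns of
   matrices over [X] are numbered by [enum_val : 'I_#|X| -> T]. *)

Section Relations.

Variables (T : finType) (X : {set T}).
Implicit Type E : {set T * T}.

Definition idrel : {set T * T} := [set p in setX X X | p.1 == p.2].

Definition simple_graph E : bool :=
  [&& E \subset setX X X,
      [forall x, (x, x) \notin E]
    & [forall x, forall y, ((x, y) \in E) == ((y, x) \in E)]].

Definition nbrs E (x : T) : {set T} := [set y in X | (x, y) \in E].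

Definition strongly_regular E (n k lam mu : nat) : Prop :=
  [/\ simple_graph E,
      #|X| = n,
      {in X, forall x, #|nbrs E x| = k}
    & {in X &, forall x y, x != y ->
        #|nbrs E x :&: nbrs E y| = if (x, y) \in E then lam else mu}].

(* The automorphisms of the graph [(X, E)], extended by the identity to
   permutations of [T]. *)
Definition graph_automorphisms E : {set {perm T}} :=
  [set p : {perm T} | perm_on X p &
    [forall x in X, forall y in X, ((p x, p y) \in E) == ((x, y) \in E)]].

Definition graph_isomorphic E (T' : finType) (X' : {set T'})
    (E' : {set T' * T'}) : Prop :=
  exists phi : T -> T',
    [/\ {in X &, injective phi},
        phi @: X = X'
      & {in X &, forall x y, ((x, y) \in E) = ((phi x, phi y) \in E')}].

Definition adjmx (F : realFieldType) E : 'M[F]_#|X| :=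
  \matrix_(x, y) ((enum_val x, enum_val y) \in E)%:R.

Section Schemes.

Variables (F : realFieldType) (d : nat) (R : 'I_d.+1 -> {set T * T}).

Let A (i : 'I_d.+1) : 'M[F]_#|X| := adjmx F (R i).

Definition adjspan : {vspace 'M[F]_#|X|} := <<[seq A i | i : 'I_d.+1]>>%VS.

Definition symmetric_scheme : Prop :=
  [/\ forall i, R i \subset setX X X,
      forall i, (A i)^T = A i,
      A ord0 = 1%:M,
      \sum_i A i = const_mx 1
    & {in adjspan &, forall M N, M *m N \in adjspan /\ M *m N = N *m M}].

(* The common eigenspaces [W j] are row spaces of matrices; as the [A i] are
   symmetric, left and right eigenvectors are the same. *)
Definition eigenvalue_matrix (P : 'M[F]_d.+1) : Prop :=
  exists W : 'I_d.+1 -> 'M[F]_#|X|,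
    [/\ forall j, W j != 0 /\
          (W j :=: \bigcap_(i < d.+1) eigenspace (A i) (P j i))%MS,
        (W ord0 :=: (const_mx 1 : 'rV[F]_#|X|))%MS,
        forall j k, j != k -> W j *m (W k)^T = 0,
        (\sum_(j < d.+1) W j :=: 1%:M)%MS
      & forall i a, eigenvalue (A i) a ->
          exists J : {set 'I_d.+1},
            (eigenspace (A i) a :=: \sum_(j in J) W j)%MS].

End Schemes.

Section Actions.

Variables (gT : finGroupType) (G : {group gT}) (to : {action gT &-> T}).

Definition generously_transitive : Prop :=
  {in X &, forall x y, exists2 g, g \in G & to x g = y /\ to y g = x}.

Definition orbital (p : T * T) : {set T * T} :=
  [set (to p.1 g, to p.2 g) | g in G].

Definition orbitals : {set {set T * T}} := orbital @: setX X X.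

(* The permutation group induced by [G] on [X], when [G] preserves [X]. *)
Definition induced_perms : {set {perm T}} :=
  [set restr_perm X (actperm to g) | g in G].

End Actions.

End Relations.

(* The coordinates 1, ..., 9 are numbered 0, ..., 8. *)
Notation vec := 'rV['F_2]_9.

Section FiniteSubspaces.

Variables (F : finFieldType) (vT : vectType F).

HB.instance Definition _ : isCountable {vspace vT} :=
  CanIsCountable (@VectorInternalTheory.vs2mxK F vT).
HB.instance Definition _ : isFinite {vspace vT} :=
  CanIsFinite (@VectorInternalTheory.vs2mxK F vT).

End FiniteSubspaces.

Definition V : {vspace vec} := lker (linfun (mulmxr (const_mx 1 : 'cV['F_2]_9))).

Lemma memV (v : vec) : (v \in V) = (\sum_i v 0 i == 0).
Proof.
have vE : v *m (const_mx 1 : 'cV['F_2]_9) = (\sum_i v 0 i)%:M.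
  apply/matrixP => i j; rewrite !ord1 !mxE.
  by apply: eq_bigr => k _; rewrite mxE mulr1.
rewrite memv_ker lfunE /= vE; apply/eqP/eqP => [/matrixP/(_ 0 0)|->].
  by rewrite !mxE.
exact: raddf0.
Qed.

(* Over 'F_2 a projective point has exactly one nonzero coordinate vector, with
   which it is identified. *)
Definition points : {set vec} := [set v in V | v != 0].

Definition f (v : vec) : 'F_2 :=
  \sum_(i < 9) \sum_(j < 9 | (i < j)%N) v 0 i * v 0 j.

Definition B (u v : vec) : 'F_2 := f (u + v) - f u - f v.

Definition isotropic_points : {set vec} := [set v in points | f v == 0].
Definition anisotropic_points : {set vec} := [set v in points | f v != 0].

Definition NOplus82_compl : {set vec * vec} :=
  [set p in setX anisotropic_points anisotropic_points
   | (p.1 != p.2) && (B p.1 p.2 != 0)].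

(* Projective dimension, -1 for the zero subspace. *)
Definition pdim (U : {vspace vec}) : int := (\dim U)%:Z - 1.

Definition totally_isotropic (U : {vspace vec}) : bool :=
  (U <= V)%VS && [forall v in points, (v \in U) ==> (v \in isotropic_points)].

Definition generators : {set {vspace vec}} :=
  [set U | totally_isotropic U
         & [forall W, totally_isotropic W && (U <= W)%VS ==> (W == U)]].

Definition same_system (U W : {vspace vec}) : bool :=
  odd `|pdim (U :&: W)%VS|%N.

Definition systems : {set {set {vspace vec}}} :=
  [set [set W in generators | same_system U W] | U in generators].

Notation genset := {set {vspace vec}}.

Definition spread (S : genset) : bool :=
  [&& S \subset generators,
      [forall U in S, forall W in S, (U != W) ==> ((U :&: W)%VS == 0%VS)]
    & [forall v in isotropic_points, exists U in S, v \in U]].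

Definition spreads_in (Y : genset) : {set genset} :=
  [set S | spread S & S \subset Y].

(* [Q i] is 0 in position [i] and 1 elsewhere. *)
Definition Q (i : 'I_9) : vec := \row_j (j != i)%:R.

(* The element of [S] containing [Q i]: unique when [S] is a spread. *)
Definition elt (S : genset) (i : 'I_9) : {vspace vec} :=
  odflt 0%VS [pick U in S | Q i \in U].

Definition c1 : 'I_9 := inord 0.
Definition c2 : 'I_9 := inord 1.

Definition Inv1 (S T : genset) : int :=
  pdim (elt S c1 :&: elt T c2)%VS + pdim (elt S c2 :&: elt T c1)%VS.

Definition Inv2 (S T : genset) : nat :=
  #|[set U in [set elt T i | i : 'I_9 & i \notin [set c1; c2]]
     | (pdim (U :&: elt S c1)%VS == 1) && (pdim (U :&: elt S c2)%VS == 1)]|.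

(* The vector [v] is sent to the vector whose coordinate in position [s i] is
   [v 0 i]; in particular [Q i] is sent to [Q (s i)]. *)
Definition perm_space (U : {vspace vec}) (s : 'S_9) : {vspace vec} :=
  (linfun (col_perm s^-1 : vec -> vec) @: U)%VS.

Lemma col_perm_Q (i : 'I_9) (s : 'S_9) : col_perm s^-1 (Q i) = Q (s i).
Proof. by apply/rowP => j; rewrite !mxE (canF_eq (permKV s)). Qed.

Lemma perm_space1 : perm_space^~ 1%g =1 id.
Proof.
move=> U; rewrite /perm_space invg1.
have -> : linfun (col_perm 1 : vec -> vec) = \1%VF.
  by apply/lfunP => v; rewrite !lfunE /= col_perm1.
exact: lim1g.
Qed.

Lemma perm_spaceM (U : {vspace vec}) : act_morph perm_space U.
Proof.
move=> s t; rewrite /perm_space -limg_comp; congr (_ @: _)%VS.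
by apply/lfunP => v; rewrite comp_lfunE !lfunE /= -col_permM invMg.
Qed.

Canonical space_action := TotalAction perm_space1 perm_spaceM.

Definition spread_action : {action 'S_9 &-> genset} := (space_action^*)%act.

Definition Gstar : {group 'S_9} := 'N_('Alt_('I_9))([set c1; c2] | 'P)%G.

(* The values of (Inv_1, Inv_2) on R_1, ..., R_6. *)
Definition inv_table : seq (int * nat) :=
  [:: (2, 0%N); (- 2, 0%N); (- 2, 2%N); (2, 2%N); (0, 1%N); (0, 3%N)].

Definition Rel (X : {set genset}) (i : 'I_7) : {set genset * genset} :=
  if i == ord0 then idrel X else
  [set p in setX X X | (p.1 != p.2) &&
     ((Inv1 p.1 p.2, Inv2 p.1 p.2) == nth (0, 0%N) inv_table i.-1)].

Definition union_Rel (X : {set genset}) (I : {set 'I_7}) :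
    {set genset * genset} :=
  \bigcup_(i in I) Rel X i.

Definition P_table : seq (seq int) :=
  [:: [:: 1;   7;  14;  21;  21;  42;  14];
      [:: 1;   2;   4; - 9;   6; - 3; - 1];
      [:: 1; - 1; - 2;   3;   3; - 6;   2];
      [:: 1; - 4; - 2; - 3;   0;   9; - 1];
      [:: 1;   3; - 2;   3; - 1;   2; - 6];
      [:: 1; - 2;   8;   3; - 6; - 3; - 1];
      [:: 1;   3; - 2; - 3; - 7;   2;   6]].

Definition Pmx (F : realFieldType) : 'M[F]_7 :=
  \matrix_(j, i) (nth 0 (nth [::] P_table j) i)%:~R.

Definition col7 (F : realFieldType) (s : seq int) : 'cV[F]_7 :=
  \col_i (nth 0 s i)%:~R.

Definition I56 : {set 'I_7} := [set inord 5; inord 6].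
Definition I346 : {set 'I_7} := [set inord 3; inord 4; inord 6].

(* Main.v *)
(* A vector of [F_2^9] is singular iff its weight is divisible by 4.  Since 120 is
   prime to 7, a member of [X] has a stabiliser of order divisible by 7, so by
   Sylow some spread of [X] is fixed by the 7-cycle on the last seven coordinates.
   Its generators through [Q_1] and [Q_2] are extended cyclic Hamming codes and
   determine the one through [Q_3], hence the spread, up to the transposition of
   the first two coordinates, which commutes with [Gstar].  The stabiliser of this
   standard spread in [Gstar], identified with Sym_7, is AGL(1,7), which is sharply
   2-transitive; so the permutations fixing two of the seven points act regularly
   on [X], and the relation of two spreads is a function on a group of order 120,
   given by a table.

   One representative per relation suffices to compute intersection numbers,
   which yield the eigenvalues and the strongly regular unions.  The adjacency
   matrix of [R_5 u R_6] is modulo 2 a Gram matrix of rank 8, which gives the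
   isomorphism with the complement of NO+(8,2).  In the graph [R_3 u R_4 u R_6]
   the number of edges in the common neighbourhood of two vertices tells the
   relations apart, so an automorphism preserves each of them; and an automorphism
   that fixes a vertex is determined by its action on the seven spreads in relation
   [R_1] to it, which is that of an element of AGL(1,7). *)
Require Import Defs.
From HB Require Import structures.
From mathcomp Require Import all_boot all_order all_algebra.
From mathcomp Require Import all_fingroup all_solvable all_field reals.
From mathcomp Require boolp.

Set Implicit Arguments.
Unset Strict Implicit.
Unset Printing Implicit Defensive.

Import Order.TTheory GRing.Theory Num.Theory.
Local Open Scope ring_scope.

Local Notation c1 := Defs.c1.
Local Notation c2 := Defs.c2.

(** * Vectors as bit strings *)

(** Subspaces and permutations do not compute, so a vector is replaced by its bit string, a subspace
    by the list of all sums of a basis, a permutation by the list of its images; each [check_] lemma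
    is a finite test on such lists. That [std_spread] is a spread is never tested: it is obtained as
    the image of a spread of the orbit. The transposition of the first two coordinates is the
    reflection in a nonsingular vector, so it interchanges the two systems of generators; the
    boolean [b] records whether it has to be applied, and it drops out of the computations because
    it preserves both invariants. With A = AGL(1,7), the spread [pt s] depends only on the coset A
    s, and the relation of [pt s] and [pt t] is given by the double coset of t s^-1; this is where
    [cdiv] comes from. The parts on combinatorics, isomorphism, automorphisms and eigenvalues see X
    only through an index [r x y] of the relation and the list [codes], so that no spread is ever
    unfolded there. *)

Definition vec_of (l : bitseq) : vec := \row_i (nth false l i)%:R.

Definition bits_of (v : vec) : bitseq := [seq v 0 i != 0 | i <- enum 'I_9].

Lemma F2E (a : 'F_2) : a = (a != 0)%:R.
Proof. by apply/val_inj; case: a => [[|[|m]]]. Qed.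

Lemma size_bits_of v : size (bits_of v) = 9%N.
Proof. by rewrite size_map size_enum_ord. Qed.

Lemma nth_bits_of v (i : 'I_9) : nth false (bits_of v) i = (v 0 i != 0).
Proof. by rewrite (nth_map i) ?size_enum_ord // nth_ord_enum. Qed.

Lemma bits_ofK : cancel bits_of vec_of.
Proof. by move=> v; apply/rowP=> i; rewrite mxE nth_bits_of -F2E. Qed.

Lemma vec_ofK l : size l = 9%N -> bits_of (vec_of l) = l.
Proof.
move=> sl; apply: (@eq_from_nth _ false); rewrite size_bits_of // => i lt_i9.
rewrite (nth_bits_of _ (Ordinal lt_i9)) mxE /=; by case: nth.
Qed.

Definition wt (v : vec) : nat := #|[set i | v 0 i != 0]|.

Lemma wt_bits v : wt v = count id (bits_of v).
Proof.
rewrite /wt /bits_of count_map cardE -size_filter.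
by rewrite [in RHS]/enum_mem -filter_predI; congr size; apply: eq_filter => i;
  rewrite /= !inE andbT.
Qed.

Definition bits_add (l l' : bitseq) : bitseq := [seq p.1 (+) p.2 | p <- zip l l'].

Lemma size_bits_add l l' : size l' = size l -> size (bits_add l l') = size l.
Proof. by move=> e; rewrite size_map size_zip e minnn. Qed.

Lemma vec_of_add l l' :
  size l = 9%N -> size l' = 9%N -> vec_of (bits_add l l') = vec_of l + vec_of l'.
Proof.
move=> sl sl'; apply/rowP=> i; rewrite !mxE.
rewrite (nth_map (false, false)) ?size_zip ?sl ?sl' // nth_zip ?sl ?sl' //=.
by case: nth; case: nth; apply/val_inj.
Qed.

Fixpoint bitseqs (n : nat) : seq bitseq :=
  if n is n'.+1 then
    [seq false :: l | l <- bitseqs n'] ++ [seq true :: l | l <- bitseqs n']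
  else [:: [::]].

Lemma mem_bitseqs n l : (l \in bitseqs n) = (size l == n).
Proof.
elim: n l => [|n IHn] [|b l]; rewrite ?inE //= mem_cat.
  by apply/negbTE; rewrite negb_or; apply/andP; split; apply/mapP => -[].
rewrite eqSS -IHn; case: b.
  rewrite mem_map => [|? ? [] //]; rewrite orbC; case: (l \in _) => //=.
  by apply/mapP => -[].
rewrite mem_map => [|? ? [] //]; case: (l \in _) => //=.
by apply/mapP => -[].
Qed.

Lemma sum_wt (v : vec) : \sum_i v 0 i = (wt v)%:R.
Proof.
rewrite /wt cardsE -sum1_card natr_sum [RHS]big_mkcond /=; apply: eq_bigr => i _.
by rewrite [LHS]F2E unfold_in /=; case: eqP.
Qed.

(** The sum counts the pairs of ones: a leading one forms a pair with each later one, which is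
    Pascal's rule. *)
Lemma sum_pairs_bits n l : size l = n ->
  \sum_(i < n) \sum_(j < n | (i < j)%N) (nth false l i)%:R * (nth false l j)%:R
    = ('C(count id l, 2))%:R :> 'F_2.
Proof.
elim: n l => [|n IHn] [|b l] //=; first by rewrite big_ord0.
move=> [sl]; rewrite big_ord_recl /= big_mkcond big_ord_recl /= add0r.
rewrite [X in _ + X = _](_ : _ = 'C(count id l, 2)%:R :> 'F_2); last first.
  rewrite -(IHn l) //; apply: eq_bigr => i _.
  by rewrite big_mkcond big_ord_recl /= add0r [RHS]big_mkcond;
    apply: eq_bigr => j _; rewrite !add0n.
rewrite [X in X + _ = _](_ : _ = b%:R * (count id l)%:R); last first.
  rewrite -mulr_sumr; congr (_ * _).
  rewrite -[LHS](big_mkord xpredT (fun i => (nth false l i)%:R)).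
  rewrite -sum1_count natr_sum [RHS]big_mkcond [RHS](big_nth false) sl.
  by apply: eq_bigr => k _; case: nth.
by case: b; rewrite ?mul1r ?mul0r ?add0r //= binS bin1 natrD addrC.
Qed.

Lemma f_wt (v : vec) : f v = 'C(wt v, 2)%:R.
Proof.
rewrite wt_bits -(sum_pairs_bits (size_bits_of v)); apply: eq_bigr => i _.
by apply: eq_bigr => j _; rewrite !nth_bits_of -!F2E.
Qed.

Definition singular (v : vec) := (4 %| wt v)%N.

Lemma natF2_eq0 n : (n%:R == 0 :> 'F_2) = ~~ odd n.
Proof. by rewrite -(dvdn_pcharf (pchar_Fp (isT : prime 2))) dvdn2. Qed.

Lemma wt_le9 v : (wt v <= 9)%N.
Proof. by rewrite /wt (leq_trans (max_card _)) ?card_ord. Qed.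

Lemma memV_wt v : (v \in V) = ~~ odd (wt v).
Proof. by rewrite memV sum_wt natF2_eq0. Qed.

(** For an even weight w, the number w(w-1)/2 is even exactly when 4 divides w. *)
Lemma singularE v : singular v = (v \in V) && (f v == 0).
Proof.
rewrite memV_wt f_wt natF2_eq0 /singular.
by have := wt_le9 v; case: (wt v) => [|[|[|[|[|[|[|[|[|[|]]]]]]]]]].
Qed.

Lemma nonsingularE v : (v \in anisotropic_points) = (wt v %% 4 == 2)%N.
Proof.
rewrite !inE memV_wt f_wt natF2_eq0.
have [->|_] := eqVneq v 0.
  by rewrite andbF /wt (_ : [set _ | _] = set0) ?cards0 //; apply/setP=> i;
    rewrite !inE mxE.
by have := wt_le9 v; case: (wt v) => [|[|[|[|[|[|[|[|[|[|]]]]]]]]]].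
Qed.

Lemma wt_col_perm s v : wt (col_perm s v) = wt v.
Proof.
rewrite /wt -(card_imset (mem [set i | v 0 i != 0]) (@perm_inj _ s^-1%g)).
congr #|pred_of_set _|; apply/setP=> i; rewrite !inE mxE.
apply/idP/imsetP => [vi|[j]]; first by exists (s i); rewrite ?inE ?permK.
by rewrite inE => vj ->; rewrite permKV.
Qed.

(** * Subspaces spanned by bit strings *)

Definition len9 (l : bitseq) := size l == 9%N.

Fixpoint sums (bs : seq bitseq) : seq bitseq :=
  if bs is b :: bs' then
    let s := sums bs' in s ++ [seq bits_add b l | l <- s]
  else [:: nseq 9 false].

Definition gspace (bs : seq bitseq) : {vspace vec} :=
  <<[seq vec_of b | b <- bs]>>%VS.

Lemma sums_len9 bs : all len9 bs -> all len9 (sums bs).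
Proof.
elim: bs => //= b bs IH /andP[/eqP sb /IH IHs]; rewrite all_cat IHs /=.
rewrite all_map; apply/allP => l /(allP IHs) /eqP sl.
by rewrite /= /len9 size_bits_add sb.
Qed.

Lemma bits_of_inj : injective bits_of.
Proof. exact: can_inj bits_ofK. Qed.

Lemma bits_of0 : bits_of 0 = nseq 9 false.
Proof.
rewrite -[RHS]vec_ofK //; congr bits_of; apply/rowP=> j.
by rewrite !mxE nth_nseq if_same.
Qed.

Lemma bits_of_add u v : bits_of (u + v) = bits_add (bits_of u) (bits_of v).
Proof.
rewrite -[u in LHS]bits_ofK -[v in LHS]bits_ofK -vec_of_add ?size_bits_of //.
by rewrite vec_ofK // size_bits_add !size_bits_of.
Qed.

(** Over F_2 a span consists of the subset sums of its generators, so membership becomes a test in a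
    list. *)
Lemma mem_gspace bs v : all len9 bs -> (v \in gspace bs) = (bits_of v \in sums bs).
Proof.
rewrite /gspace; elim: bs v => [|b bs IH] v /=.
  rewrite span_nil memv0 inE => _.
  by rewrite -[_ :: _]/(nseq 9 false) -bits_of0 (inj_eq bits_of_inj).
case/andP=> /eqP sb al; rewrite span_cons mem_cat -IH //.
apply/memv_addP/orP => [[w /vlineP[k ->] [u us ->]]|[vs|/mapP[l ls ev]]].
- rewrite (F2E k); case: (k != 0) => /=; rewrite ?scale0r ?scale1r ?add0r; last by left.
  right; apply/mapP; exists (bits_of u); first by rewrite -IH.
  by rewrite bits_of_add vec_ofK.
- by exists 0; rewrite ?mem0v //; exists v; rewrite ?add0r.
- have sl : size l = 9%N by apply/eqP/(allP (sums_len9 al)).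
  exists (vec_of b); rewrite ?memv_line //; exists (vec_of l).
    by rewrite IH // vec_ofK.
  by apply: bits_of_inj; rewrite ev -vec_of_add // vec_ofK // size_bits_add sb.
Qed.

Lemma card_F2_space (U : {vspace vec}) : #|U| = (2 ^ \dim U)%N.
Proof. by rewrite card_vspace card_Fp //. Qed.

(** The dimension is read off the cardinality of the intersection; [uniq (sums bs)] prevents a
    common vector from being counted twice. *)
Lemma dim_gspaceI bs cs d :
    all len9 bs -> all len9 cs -> uniq (sums bs) ->
    count (mem (sums cs)) (sums bs) = (2 ^ d)%N ->
  \dim (gspace bs :&: gspace cs)%VS = d.
Proof.
move=> lb lc ub cnt; apply/eqP; rewrite -(eqn_exp2l _ _ (isT : 1 < 2)%N).
rewrite -card_F2_space -cnt -size_filter.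
rewrite -(size_map vec_of) -(card_uniqP _); last first.
  rewrite map_inj_in_uniq ?filter_uniq // => l l'; rewrite !mem_filter.
  case/andP=> _ /(allP (sums_len9 lb))/eqP sl /andP[_ /(allP (sums_len9 lb))/eqP sl'].
  by move=> e; rewrite -(vec_ofK sl) e vec_ofK.
apply/eqP/eq_card => v; rewrite memv_cap !mem_gspace //.
apply/andP/mapP => [[vb vc]|[l]].
  by exists (bits_of v); rewrite ?bits_ofK // mem_filter /= vc.
rewrite mem_filter /= => /andP[lsc lsb] ->.
by have /eqP sl := allP (sums_len9 lb) _ lsb; rewrite vec_ofK.
Qed.

(** * Codes of permutations *)

Definition code n (s : 'S_n) : seq nat := [seq val (s i) | i <- enum 'I_n].

Lemma size_code n (s : 'S_n) : size (code s) = n.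
Proof. by rewrite size_map size_enum_ord. Qed.

Lemma nth_code n (s : 'S_n) (i : 'I_n) : nth 0%N (code s) i = s i.
Proof. by rewrite (nth_map i) ?size_enum_ord // nth_ord_enum. Qed.

Lemma code_inj n : injective (@code n).
Proof.
move=> s t e; apply/permP => i; apply: val_inj; by rewrite /= -!nth_code e.
Qed.

Lemma code_eq n (s : 'S_n) (c : seq nat) :
  size c = n -> (forall i : 'I_n, nth 0%N c i = s i) -> code s = c.
Proof.
move=> sc h; apply: (@eq_from_nth _ 0%N); rewrite size_code ?sc // => i lt_in.
by rewrite (nth_code s (Ordinal lt_in)) -h.
Qed.

Definition cmul (c d : seq nat) : seq nat := [seq nth 0%N d k | k <- c].

Lemma code_mul n (s t : 'S_n) : code (s * t) = cmul (code s) (code t).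
Proof.
apply: code_eq => [|i]; first by rewrite size_map size_code.
by rewrite (nth_map 0%N) ?size_code // !nth_code permM.
Qed.

Definition wf_code n (c : seq nat) := [&& size c == n, all (ltn^~ n) c & uniq c].

Arguments wf_code n%_N c.

Lemma perm_of_code n c : wf_code n c -> exists s : 'S_n, code s = c.
Proof.
case/and3P=> /eqP sc lt_c uc.
have lt_nth i : (i < n)%N -> (nth 0%N c i < n)%N.
  by move=> lt_in; apply: (allP lt_c); rewrite mem_nth ?sc.
pose g (i : 'I_n) := Ordinal (lt_nth i (ltn_ord i)).
have g_inj : injective g.
  move=> i j /(congr1 val) /= /eqP; rewrite nth_uniq ?sc // => /eqP.
  exact: val_inj.
by exists (perm g_inj); apply: code_eq => // i; rewrite permE.
Qed.

Definition permc n (c : seq nat) : 'S_n := odflt 1%g [pick s : 'S_n | code s == c].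

Arguments permc n%_N c.

Lemma permcK n c : wf_code n c -> code (permc n c) = c.
Proof.
move=> /perm_of_code[s es]; rewrite /permc.
by case: pickP => [t /eqP //|/(_ s)]; rewrite es eqxx.
Qed.

Lemma codeK n : cancel (@code n) (permc n).
Proof.
by move=> s; apply: code_inj; rewrite /permc; case: pickP => [t /eqP //|/(_ s)/eqP[]].
Qed.

Definition cinv n (c : seq nat) : seq nat := [seq index k c | k <- iota 0 n].

Arguments cinv n%_N c.

Lemma code_inv n (s : 'S_n) : code s^-1%g = cinv n (code s).
Proof.
apply/esym; symmetry; apply: code_eq => [|i]; first by rewrite size_map size_iota.
rewrite (nth_map 0%N) ?size_iota // nth_iota // add0n.
rewrite -[i in LHS](permKV s) -nth_code index_uniq ?size_code //.
by rewrite map_inj_uniq ?enum_uniq // => j k /val_inj/perm_inj.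
Qed.

Lemma code1 n : code (1 : 'S_n)%g = iota 0 n.
Proof. by apply: code_eq => [|i]; rewrite ?size_iota ?nth_iota ?perm1. Qed.

Definition bits_perm (c : seq nat) (l : bitseq) : bitseq := [seq nth false l k |
  k <- c].

Lemma vec_of_perm (s : 'S_9) l : col_perm s (vec_of l) = vec_of (bits_perm (code s) l).
Proof.
apply/rowP=> i; rewrite !mxE (nth_map 0%N) ?size_code //.
by rewrite nth_code.
Qed.

Lemma bits_of_perm (s : 'S_9) v : bits_of (col_perm s v) =
  bits_perm (code s) (bits_of v).
Proof.
by rewrite -{1}[v]bits_ofK vec_of_perm vec_ofK // size_map size_code.
Qed.

Lemma perm_gspace (s : 'S_9) bs :
  perm_space (gspace bs) s = gspace [seq bits_perm (cinv 9 (code s)) b | b <- bs].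
Proof.
rewrite /perm_space /gspace limg_span -!map_comp; congr (<< _ >>)%VS.
by apply: eq_map => b /=; rewrite lfunE /= vec_of_perm code_inv.
Qed.

(** * Spreads and coordinate permutations *)

Lemma mem_perm_space (s : 'S_9) U v : (v \in perm_space U s) = (col_perm s v \in U).
Proof.
apply/memv_imgP/idP => [[u Uu ->]|Uv].
  by rewrite lfunE /= -col_permM mulgV col_perm1.
by exists (col_perm s v); rewrite ?lfunE //= -col_permM mulVg col_perm1.
Qed.

Lemma col_perm_eq0 (s : 'S_9) (v : vec) : (col_perm s v == 0) = (v == 0).
Proof.
apply/eqP/eqP => [e|->]; last exact: linear0.
by rewrite -[v]col_perm1 -(mulVg s) col_permM e linear0.
Qed.

Lemma perm_space_cap (s : 'S_9) U W :
  (perm_space U s :&: perm_space W s)%VS = perm_space (U :&: W)%VS s.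
Proof. by apply/vspaceP => v; rewrite memv_cap !mem_perm_space memv_cap. Qed.

Lemma dim_perm_space (s : 'S_9) U : \dim (perm_space U s) = \dim U.
Proof.
apply: limg_dim_eq; apply/eqP; rewrite -subv0; apply/subvP => v.
by rewrite memv_cap memv_ker lfunE memv0 /= col_perm_eq0 => /andP[].
Qed.

Lemma perm_space_sub (s : 'S_9) U W : (perm_space U s <= perm_space W s)%VS =
  (U <= W)%VS.
Proof.
apply/subvP/subvP => sUW v => [Uv|]; last by rewrite !mem_perm_space => /sUW.
have := sUW (col_perm s^-1%g v).
by rewrite !mem_perm_space -col_permM mulgV col_perm1; apply.
Qed.

Lemma singular_col_perm s v : singular (col_perm s v) = singular v.
Proof. by rewrite /singular wt_col_perm. Qed.

Lemma totally_isotropicE (U : {vspace vec}) :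
  totally_isotropic U = [forall v, (v \in U) ==> singular v].
Proof.
apply/andP/forallP => [[/subvP UV /forallP h] v|h].
  apply/implyP => Uv; have [->|v0] := eqVneq v 0.
    by rewrite /singular wt_bits bits_of0.
  have := h v; rewrite inE v0 UV //= Uv /= !inE => /andP[_ fv].
  by rewrite singularE UV.
have sU v : v \in U -> singular v by apply/implyP/h.
split; first by apply/subvP => v /sU; rewrite singularE => /andP[].
apply/forallP => v; apply/implyP => Pv; apply/implyP => /sU.
by rewrite inE Pv singularE => /andP[].
Qed.

Lemma totally_isotropicP (U : {vspace vec}) :
  reflect (forall v, v \in U -> singular v) (totally_isotropic U).
Proof.
rewrite totally_isotropicE; apply: (iffP forallP) => h v; last exact/implyP/h.
exact/implyP.
Qed.

Lemma totally_isotropic_perm (s : 'S_9) (U : {vspace vec}) :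
  totally_isotropic (perm_space U s) = totally_isotropic U.
Proof.
apply/totally_isotropicP/totally_isotropicP => h v Uv; last first.
  by rewrite -(singular_col_perm s) h // -mem_perm_space.
by rewrite -(singular_col_perm s^-1) h // mem_perm_space -col_permM mulgV col_perm1.
Qed.

Lemma generatorP (U : {vspace vec}) :
  reflect (totally_isotropic U /\
           forall W, totally_isotropic W -> (U <= W)%VS -> W = U)
          (U \in generators).
Proof.
rewrite inE; apply: (iffP andP) => -[tU h]; split=> //.
  by move=> W tW UW; apply/eqP; apply: (implyP (forallP h W)); rewrite tW.
by apply/forallP => W; apply/implyP => /andP[tW UW]; apply/eqP/h.
Qed.

Lemma perm_spaceK (s : 'S_9) : cancel (perm_space^~ s) (perm_space^~ s^-1%g).
Proof. by move=> U; rewrite -perm_spaceM mulgV perm_space1. Qed.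

Lemma perm_spaceVK (s : 'S_9) : cancel (perm_space^~ s^-1%g) (perm_space^~ s).
Proof. by move=> U; rewrite -perm_spaceM mulVg perm_space1. Qed.

Lemma generator_perm (s : 'S_9) (U : {vspace vec}) : U \in generators ->
  perm_space U s \in generators.
Proof.
move=> /generatorP[tU h]; apply/generatorP; rewrite totally_isotropic_perm.
split=> // W tW UW; rewrite -[W](perm_spaceVK s); congr perm_space; apply: h.
  by rewrite totally_isotropic_perm.
by rewrite -(perm_space_sub s) perm_spaceVK.
Qed.

Lemma mem_spread_act (S : genset) (s : 'S_9) U :
  (U \in spread_action S s) = (perm_space U s^-1%g \in S).
Proof.
apply/imsetP/idP => [[W WS ->]|US]; first by rewrite /= perm_spaceK.
by exists (perm_space U s^-1%g); rewrite /= ?perm_spaceVK.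
Qed.

Lemma spreadP (S : genset) :
  reflect [/\ {subset S <= generators},
              {in S &, forall (U W : {vspace vec}) v, v \in U -> v \in W ->
                v != 0 -> U = W}
            & forall v, singular v -> v != 0 -> exists2 U, U \in S & v \in U]
          (spread S).
Proof.
apply: (iffP and3P) => -[/subsetP Sg Sd Sc]; split=> //.
- move=> U W US WS v Uv Wv v0; apply/eqP/negP => /negP UW.
  have := forallP Sd U; rewrite US /= => /forallP/(_ W); rewrite WS UW /=.
  by move/eqP/vspaceP/(_ v); rewrite memv_cap Uv Wv memv0 (negbTE v0).
- move=> v sv v0; have := forallP Sc v; rewrite !inE v0 andbT -singularE sv /=.
  by case/existsP=> U /andP[]; exists U.
- apply/forallP => U; apply/implyP => US; apply/forallP => W; apply/implyP => WS.
  apply/implyP => UW; rewrite -subv0; apply/subvP => v; rewrite memv_cap memv0.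
  by case/andP=> Uv Wv; apply: contraNT UW => v0; apply/eqP; apply: (Sd U W US WS v).
- apply/forallP => v; apply/implyP; rewrite !inE => /andP[/andP[Vv v0] fv].
  have [||U US Uv] := Sc v => //; first by rewrite singularE Vv.
  by apply/existsP; exists U; rewrite US.
Qed.

Lemma spread_act (S : genset) (s : 'S_9) : spread S -> spread (spread_action S s).
Proof.
case/spreadP=> Sg Sd Sc; apply/spreadP; split.
- by move=> _ /imsetP[U US ->]; apply/generator_perm/Sg.
- move=> _ _ /imsetP[U US ->] /imsetP[W WS ->] v /=;
  rewrite !mem_perm_space => Uv Wv v0.
  by rewrite (Sd U W US WS _ Uv Wv) // col_perm_eq0.
- move=> v sv v0; have [||U US Uv] := Sc (col_perm s v).
  + by rewrite singular_col_perm.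
  + by rewrite col_perm_eq0.
  by exists (perm_space U s); rewrite ?mem_perm_space // mem_spread_act perm_spaceK.
Qed.

Lemma bits_of_Q (i : 'I_9) : bits_of (Q i) = [seq k != i :> nat | k <- iota 0 9].
Proof.
apply: (@eq_from_nth _ false); rewrite size_bits_of ?size_map ?size_iota // => j j9.
rewrite (nth_bits_of _ (Ordinal j9)) mxE (nth_map 0%N) ?size_iota // nth_iota //.
by rewrite add0n -[Ordinal j9 != i]/(j != i :> nat); case: (j != i :> nat).
Qed.

Lemma Q_neq0 i : Q i != 0.
Proof.
rewrite -(inj_eq bits_of_inj) bits_of_Q bits_of0.
by case: i => [[|[|[|[|[|[|[|[|[|]]]]]]]]]].
Qed.

Lemma singular_Q i : singular (Q i).
Proof.
rewrite /singular wt_bits bits_of_Q.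
by case: i => [[|[|[|[|[|[|[|[|[|]]]]]]]]]].
Qed.

Lemma elt_eq (S : genset) i U : spread S -> U \in S -> Q i \in U -> elt S i = U.
Proof.
case/spreadP=> _ Sd _ US QU; rewrite /elt; case: pickP => [W /andP[WS QW]|/(_ U)] /=.
  exact: (Sd W U WS US (Q i) QW QU (Q_neq0 i)).
by rewrite US QU.
Qed.

Lemma mem_elt S i : spread S -> elt S i \in S /\ Q i \in elt S i.
Proof.
move=> spS; case/spreadP: (spS) => _ _ /(_ _ (singular_Q i) (Q_neq0 i))[U US QU].
by rewrite (elt_eq spS US QU).
Qed.

Lemma elt_act S (s : 'S_9) i : spread S ->
  elt (spread_action S s) (s i) = perm_space (elt S i) s.
Proof.
move=> spS; have [eS Qe] := mem_elt i spS; apply: elt_eq; first exact: spread_act.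
  by rewrite mem_spread_act perm_spaceK.
by rewrite mem_perm_space -(col_perm_Q i s) -col_permM mulgV col_perm1.
Qed.

Lemma singularD_Q i j : i != j -> ~~ singular (Q i + Q j).
Proof.
rewrite -val_eqE /singular wt_bits bits_of_add !bits_of_Q.
case: i => [[|[|[|[|[|[|[|[|[|]]]]]]]]]] //;
  by case: j => [[|[|[|[|[|[|[|[|[|]]]]]]]]]].
Qed.

(** Two points [Q i] and [Q j] have a sum of weight 2, which is nonsingular, so no generator
    contains both. *)
Lemma elt_inj S : spread S -> injective (elt S).
Proof.
move=> spS i j e; apply/eqP/negP => /negP /singularD_Q.
have [eS Qe] := mem_elt i spS; have [_ Qj] := mem_elt j spS.
case/spreadP: spS => /(_ _ eS)/generatorP[/totally_isotropicP tU _] _ _.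
by rewrite tU // memvD // e.
Qed.

Definition meet_dim (S T : genset) (i j : 'I_9) : nat := \dim (elt S i :&: elt T j).

Lemma meet_dim_act S T (s : 'S_9) i j : spread S -> spread T ->
  meet_dim (spread_action S s) (spread_action T s) (s i) (s j) = meet_dim S T i j.
Proof.
by move=> spS spT; rewrite /meet_dim !elt_act // perm_space_cap dim_perm_space.
Qed.

Lemma Inv1E S T :
  Inv1 S T = (meet_dim S T c1 c2 + meet_dim S T c2 c1)%:Z - 2.
Proof. by rewrite /Inv1 /pdim addrACA PoszD -opprD. Qed.

(** Since [elt T] is injective, indices can be counted in place of generators; projective dimension
    1 is vector dimension 2. *)
Lemma Inv2E S T : spread T -> Inv2 S T =
  #|[set i | [&& i \notin [set c1;
    c2], meet_dim S T c1 i == 2 & meet_dim S T c2 i == 2]]%N|.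
Proof.
move=> spT; rewrite -(card_imset _ (elt_inj spT)); congr #|pred_of_set _|.
have e U W : (pdim (U :&: W)%VS == 1) = (\dim (W :&: U) == 2)%N.
  by rewrite /pdim subr_eq capvC.
apply/setP=> U; rewrite inE !e; apply/andP/imsetP => [[/imsetP[i]]|[i]].
  by rewrite inE => ni -> /andP[d1 d2]; exists i; rewrite // inE ni d1.
rewrite !inE => /and3P[ni d1 d2] ->; split; last by rewrite d1.
by apply/imsetP; exists i; rewrite // !inE.
Qed.

(** * The group [Gstar] *)

Definition c12 : 'S_9 := tperm c1 c2.

Definition stab12 (g : 'S_9) : bool :=
  (g c1 == c1) && (g c2 == c2) || (g c1 == c2) && (g c2 == c1).

Lemma val_c1 : c1 = 0%N :> nat. Proof. by rewrite /c1 inordK. Qed.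
Lemma val_c2 : c2 = 1%N :> nat. Proof. by rewrite /c2 inordK. Qed.

Lemma c1_neq_c2 : c1 != c2.
Proof. by rewrite -val_eqE /= val_c1 val_c2. Qed.

Lemma c1E : c1 = ord0. Proof. exact/val_inj/val_c1. Qed.
Lemma c2E : c2 = lift ord0 ord0. Proof. exact/val_inj/val_c2. Qed.

Lemma stab12_astabs g : (g \in 'N([set c1; c2] | 'P))%g = stab12 g.
Proof.
have nc := c1_neq_c2; have nc' : (c2 == c1) = false by rewrite eq_sym (negbTE nc).
apply/astabsP/idP => [h|st x].
  have := h c1; have := h c2; rewrite !inE /= /aperm /stab12 !eqxx orbT /=.
  have : g c1 != g c2 by rewrite (inj_eq perm_inj).
  by move=> ng /orP[]/eqP e2 /orP[]/eqP e1; move: ng; rewrite e1 e2 ?eqxx ?orbT.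
have eS : g @: [set c1; c2] = [set c1; c2].
  by rewrite imsetU1 imset_set1; case/orP: st => /andP[/eqP-> /eqP->] //; rewrite setUC.
by rewrite -{1}eS /= /aperm mem_imset //; apply: perm_inj.
Qed.

Lemma GstarE g : (g \in Gstar) = ~~ odd_perm g && stab12 g.
Proof. by rewrite inE stab12_astabs -Alt_even. Qed.

Lemma stab12_Gstar g : g \in Gstar -> stab12 g.
Proof. by rewrite GstarE => /andP[]. Qed.

Lemma stab12_c12 : stab12 c12.
Proof. by rewrite /stab12 /c12 tpermL tpermR !eqxx orbT. Qed.

Lemma c12K : (c12 * c12 = 1)%g.
Proof. exact: tperm2. Qed.

Lemma c12_commute g : stab12 g -> (c12 * g = g * c12)%g.
Proof.
move=> st; suff e : (c12 ^ g = c12)%g by rewrite -{2}e conjgE !mulgA mulgV mul1g.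
rewrite tpermJ /c12; case/orP: st => /andP[/eqP-> /eqP->] //.
exact: tpermC.
Qed.

Lemma stab12_set g i : stab12 g -> (g i \in [set c1; c2]) = (i \in [set c1; c2]).
Proof.
by rewrite -stab12_astabs => /astabsP/(_ i).
Qed.

(** Stated for [stab12] rather than for [Gstar], so that it also covers the odd permutation [c12].
    If [g] swaps the first two coordinates, the two summands are exchanged. *)
Lemma Inv1_act S T (g : 'S_9) : stab12 g -> spread S -> spread T ->
  Inv1 (spread_action S g) (spread_action T g) = Inv1 S T.
Proof.
move=> st spS spT; rewrite !Inv1E.
have e1 := meet_dim_act g c1 c2 spS spT; have e2 := meet_dim_act g c2 c1 spS spT.
case/orP: st e1 e2 => /andP[/eqP-> /eqP->] -> -> //.
by rewrite addnC.
Qed.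

Lemma Inv2_act S T (g : 'S_9) : stab12 g -> spread S -> spread T ->
  Inv2 (spread_action S g) (spread_action T g) = Inv2 S T.
Proof.
move=> st spS spT; rewrite !Inv2E ?spread_act //.
rewrite -[RHS](card_imset _ (@perm_inj _ g)); congr #|pred_of_set _|.
apply/setP=> j; rewrite -[j](permKV g); move: (g^-1%g j) => i.
rewrite [in RHS](mem_imset _ _ (@perm_inj _ g)) !inE -!in_set2 stab12_set //.
have e1 := meet_dim_act g c1 i spS spT; have e2 := meet_dim_act g c2 i spS spT.
case/orP: st e1 e2 => /andP[/eqP-> /eqP->] -> -> //.
by rewrite [X in _ && X]andbC.
Qed.

Definition lift7 (s : 'S_7) : 'S_9 :=
  lift_perm ord0 ord0 (lift_perm ord0 ord0 s).

Lemma lift7M s t : lift7 (s * t) = (lift7 s * lift7 t)%g.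
Proof. by rewrite /lift7 !lift_permM. Qed.

Lemma odd_lift7 s : odd_perm (lift7 s) = odd_perm s.
Proof. by rewrite !odd_lift_perm. Qed.

Lemma lift7_1 : lift7 1 = 1%g.
Proof. by rewrite /lift7 !lift_perm1. Qed.

Lemma stab12_lift7 s : stab12 (lift7 s).
Proof. by rewrite /stab12 c1E c2E /lift7 lift_perm_lift !lift_perm_id !eqxx. Qed.

Lemma code_lift7 s : code (lift7 s) = [:: 0, 1 & [seq k.+2 | k <- code s]]%N.
Proof.
apply: code_eq => [|i]; first by rewrite /= size_map size_code.
case: (unliftP ord0 i) => [j|] ->; rewrite /lift7 ?lift_perm_id ?lift_perm_lift //=.
case: (unliftP ord0 j) => [k|] ->; rewrite ?lift_perm_id ?lift_perm_lift //=.
by rewrite [LHS](nth_map 0%N) ?size_code ?add0n ?ltn_ord // (nth_code s k).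
Qed.

(* Odd permutations of the last seven coordinates are made even by swapping
   the first two. *)
Definition emb7 (s : 'S_7) : 'S_9 := (lift7 s * c12 ^+ odd_perm s)%g.

Lemma stab12M g h : stab12 g -> stab12 h -> stab12 (g * h)%g.
Proof. by rewrite -!stab12_astabs; apply: groupM. Qed.

Lemma stab12X g n : stab12 g -> stab12 (g ^+ n)%g.
Proof. by rewrite -!stab12_astabs; apply: groupX. Qed.

Lemma emb7_Gstar s : emb7 s \in Gstar.
Proof.
rewrite GstarE stab12M ?stab12X ?stab12_lift7 ?stab12_c12 //.
rewrite odd_permM odd_lift7; case: odd_perm => /=; last by rewrite odd_perm1.
by rewrite odd_tperm c1_neq_c2.
Qed.

(** The transposition [c12] is an involution commuting with all lifted permutations. *)
Lemma emb7M s t : emb7 (s * t) = (emb7 s * emb7 t)%g.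
Proof.
rewrite /emb7 lift7M odd_permM.
have e : (lift7 t * c12 = c12 * lift7 t)%g by rewrite c12_commute ?stab12_lift7.
case: (odd_perm s); case: (odd_perm t); rewrite /= ?expg1 ?expg0 ?mulg1 ?mulgA //.
  by rewrite -[RHS]mulgA e -mulgA (mulgA c12) c12K mul1g.
by rewrite -mulgA e mulgA.
Qed.

Lemma emb7_1 : emb7 1 = 1%g.
Proof. by rewrite /emb7 lift7_1 odd_perm1 mulg1. Qed.

(** * The standard spread *)

Definition block (s : seq nat) : bitseq := [seq k \in s | k <- iota 0 9].

Definition zc : seq nat := [:: 1; 2; 3; 4; 5; 6; 0]%N.
Definition lift_code (c : seq nat) : seq nat := [:: 0, 1 & [seq k.+2 | k <- c]]%N.
Definition swap_code : seq nat := [:: 1; 0; 2; 3; 4; 5; 6; 7; 8]%N.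

(* [bits_move c] moves the bit in position [i] to the position [c_i]. *)
Definition bits_move (c : seq nat) : bitseq -> bitseq := bits_perm (cinv 9 c).
(** The stored list is the inverse of [lift_code zc], as [cinv_zperm] confirms; the tests thus avoid
    recomputing it. *)
Definition zmove : bitseq -> bitseq :=
  bits_perm [:: 0; 1; 8; 2; 3; 4; 5; 6; 7]%N.

(** Positions 2 to 8 stand for the integers mod 7. Apart from the vector [Q_1], the words consist of
    position 1 and a translate of the nonzero squares {1, 2, 4}; in [base2] they consist of position
    0 and a translate of the nonsquares {3, 5, 6}. *)
Definition base1 : seq bitseq :=
  block [:: 1; 2; 3; 4; 5; 6; 7; 8] ::
  map block [:: [:: 1; 3; 4; 6]; [:: 1; 4; 5; 7]; [:: 1; 5; 6; 8]]%N.
Definition base2 : seq bitseq :=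
  block [:: 0; 2; 3; 4; 5; 6; 7; 8] ::
  map block [:: [:: 0; 5; 7; 8]; [:: 0; 2; 6; 8]; [:: 0; 2; 3; 7]]%N.
Definition base3 : seq bitseq :=
  block [:: 0; 1; 3; 4; 5; 6; 7; 8] ::
  map block [:: [:: 1; 3; 4; 5]; [:: 0; 3; 4; 6]; [:: 0; 1; 4; 7]]%N.

Definition bases : seq (seq bitseq) :=
  [:: base1, base2 & [seq map (iter k zmove) base3 | k <- iota 0 7]].

Definition std_gen (i : nat) : {vspace vec} := gspace (nth [::] bases i).

Definition std_spread : genset := [set std_gen i | i : 'I_9].

Definition zperm : 'S_9 := emb7 (permc 7 zc).

(** A 7-cycle equals its eighth power, hence is a square. *)
Lemma odd_zperm : odd_perm (permc 7 zc) = false.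
Proof.
set s := permc 7 zc; have -> : s = (s ^+ 4 * s ^+ 4)%g.
  apply: code_inj; rewrite !expgS expg0 mulg1 !code_mul permcK //.
by rewrite odd_permM addbb.
Qed.

Lemma code_lift_permc c : wf_code 7 c -> code (lift7 (permc 7 c)) = lift_code c.
Proof. by move=> wf; rewrite code_lift7 permcK. Qed.

Lemma zpermE : zperm = lift7 (permc 7 zc).
Proof. by rewrite /zperm /emb7 odd_zperm mulg1. Qed.

Lemma code_zperm : code zperm = lift_code zc.
Proof. by rewrite zpermE code_lift_permc. Qed.

Lemma code_c12 : code c12 = swap_code.
Proof.
apply: code_eq => // i; rewrite /c12 permE /= -!val_eqE /= val_c1 val_c2.
by case: i => [[|[|[|[|[|[|[|[|[|]]]]]]]]]] //=; rewrite ?val_c1 ?val_c2.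
Qed.

Lemma singular_bits v : singular v = (count id (bits_of v) \in [:: 0; 4; 8]%N).
Proof.
rewrite /singular -wt_bits; have := wt_le9 v.
by case: (wt v) => [|[|[|[|[|[|[|[|[|[|]]]]]]]]]].
Qed.

Definition sing (l : bitseq) := count id l \in [:: 0; 4; 8]%N.

Lemma bits_moveE (s : 'S_9) v : bits_of (col_perm s^-1%g v) =
  bits_move (code s) (bits_of v).
Proof. by rewrite bits_of_perm code_inv. Qed.

Lemma mem_perm_space_bits (s : 'S_9) bs v : all len9 bs ->
  (v \in perm_space (gspace bs) s) = (bits_perm (code s) (bits_of v) \in sums bs).
Proof. by move=> lb; rewrite mem_perm_space mem_gspace // bits_of_perm. Qed.

Lemma totally_isotropic_gspace bs : all len9 bs -> all sing (sums bs) ->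
  totally_isotropic (gspace bs).
Proof.
by move=> lb /allP h; apply/totally_isotropicP => v;
  rewrite mem_gspace // => /h; rewrite singular_bits.
Qed.

Lemma F2_addNeq0 (a b : 'F_2) : a != 0 -> b != 0 -> a + b = 0.
Proof. by move=> na nb; rewrite (F2E a) (F2E b) na nb; apply/val_inj. Qed.

(** Adding [Q i] to a word of weight w that vanishes at i gives weight 8 - w. *)
Lemma singD_Q : all (fun l => all (fun i =>
    [|| nth false l i, ~~ sing l | sing (bits_add l [seq k != i | k <- iota 0 9])])
  (iota 0 9)) (bitseqs 9).
Proof. by vm_compute. Qed.

(* Double counting of the pairs (vector of [U], nonzero coordinate): a vector
   of [U] other than the [Q i] has weight 0 or 4, while a coordinate that does
   not vanish on [U] is nonzero on half of [U]. *)
Lemma generator_Q (U : {vspace vec}) : U \in generators -> exists i, Q i \in U.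
Proof.
case/generatorP=> /totally_isotropicP tU maxU; apply/existsP;
  apply: contraT => /existsPn noQ.
(* If coordinate [i] vanished on [U], then [U] together with [Q i] would still span a totally
   isotropic subspace, and maximality would put [Q i] in [U]. *)
have van i : exists2 u, u \in U & u 0 i != 0.
  have /existsP[u /andP[Uu ui]] : [exists u, (u \in U) && (u 0 i != 0)];
    last by exists u.
  apply: contraT => /existsPn h; case/negP: (noQ i).
  suff /maxU <- : totally_isotropic (U + <[Q i]>)%VS; rewrite ?addvSl //.
    by apply: (subvP (addvSr _ _)); apply: memv_line.
  apply/totally_isotropicP => _ /memv_addP[u Uu [_ /vlineP[k ->] ->]].
  rewrite (F2E k); case: (k != 0) => /=; rewrite ?scale0r ?scale1r ?addr0;
    last exact: tU.
  have := h u; rewrite Uu /= negbK => ui; have := tU u Uu.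
  rewrite !singular_bits bits_of_add bits_of_Q.
  have := nth_bits_of u i; rewrite ui /= => ni su.
  have /allP/(_ (bits_of u)) := singD_Q; rewrite mem_bitseqs size_bits_of => /(_ isT).
  by move/allP/(_ (val i)); rewrite mem_iota ltn_ord ni [sing _]su /=; apply.
have half (i : 'I_9) : (2 * #|[set u : vec in U | (u 0 i != 0)%R]| = #|U|)%N.
  have [u Uu ui] := van i.
  rewrite mul2n -addnn -[in RHS](cardID [pred v : vec | v 0 i != 0] U).
  congr (_ + _)%N; first by apply: eq_card => v; rewrite !inE andbC.
  rewrite -(card_imset _ (addrI u)); apply: eq_card => v.
  rewrite !inE negbK; apply/imsetP/andP => [[w]|[/eqP vi Uv]].
    rewrite inE => /andP[Uw wi] ->; rewrite memvD // mxE.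
    by rewrite F2_addNeq0.
  exists (v - u); last by rewrite addrC subrK.
  by rewrite inE memvB //= !mxE vi sub0r oppr_eq0.
have : (\sum_(i < 9) #|[set u : vec in U | (u 0 i != 0)%R]| = 4 * #|U|.-1)%N.
  have -> : (\sum_(i < 9) #|[set u : vec in U | (u 0 i != 0)%R]| =
    \sum_(u in U) wt u)%N.
    have card_nat (T : finType) (A : {set T}) : #|A| = (\sum_x (x \in A))%N.
      by rewrite -sum1_card big_mkcond; apply: eq_bigr => x _; case: (x \in A).
    rewrite (eq_bigr _ (fun i _ => card_nat _ _)) [RHS](eq_bigr _ (fun u _ =>
      card_nat _ _)).
    rewrite [RHS]big_mkcond exchange_big /=; apply: eq_bigr => u _.
    case Uu: (u \in U); last by rewrite big1 // => i _; rewrite !inE Uu.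
    by apply: eq_bigr => i _; rewrite !inE Uu.
  rewrite (bigD1 0) ?mem0v //= (_ : wt 0 = 0%N) ?wt_bits ?bits_of0 // add0n.
  rewrite (cardD1 0) mem0v /= -sum1_card big_distrr /= muln1.
  rewrite [RHS](eq_bigl (fun u => (u \in U) && (u != 0))); last first.
    by move=> u; rewrite !inE andbC.
  apply: eq_bigr => u /andP[Uu u0]; have := tU u Uu.
  have w0 : wt u != 0%N.
    rewrite cards_eq0; apply: contra_neq u0 => /setP e; apply/rowP=> i.
    by have := e i; rewrite !inE mxE => /negbFE/eqP.
  rewrite singular_bits -wt_bits !inE (negbTE w0) /= => /orP[/eqP //|/eqP w8].
  have : (0 < #|~: [set i | (u 0 i != 0)%R]|)%N.
    by rewrite cardsCs setCK card_ord -/(wt u) w8.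
  case/card_gt0P => i; rewrite !inE negbK => /eqP ui.
  case/negP: (noQ i); suff <- : u = Q i by [].
  apply/rowP=> j; rewrite mxE [LHS]F2E; have [->|ji] := eqVneq j i;
    first by rewrite ui eqxx.
  suff -> : u 0 j != 0 by [].
  have /eqP/setP/(_ j) : [set k | u 0 k != 0] == [set~ i].
    rewrite eqEcard cardsC1 card_ord -/(wt u) w8 andbT.
    by apply/subsetP => k; rewrite !inE; apply: contraNneq => ->; rewrite ui.
  by rewrite !inE ji.
have [n cU] : exists n, #|U| = n.+1.
  by exists #|U|.-1; rewrite prednK //; apply/card_gt0P; exists 0; rewrite mem0v.
(* Doubling gives 9 |U| = 8 (|U| - 1), which is impossible. *)
move/(congr1 (muln 2)); rewrite big_distrr /= (eq_bigr (fun=> #|U|)) => [|i _];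
  last exact: half.
rewrite sum_nat_const card_ord cU mulnA => /eqP; rewrite gtn_eqF //.
by rewrite (@leq_ltn_trans (9 * n)) ?leq_mul2r ?ltn_mul2l /= ?orbT ?ltnSn.
Qed.

(** Every generator contains some [Q i], so the elements through these nine points exhaust the
    spread. *)
Lemma spreadE S : spread S -> S = [set elt S i | i : 'I_9].
Proof.
move=> spS; apply/setP=> U; apply/idP/imsetP => [US|[i _ ->]];
  last by case: (mem_elt i spS).
have [i QU] : exists i, Q i \in U by apply: generator_Q; case/spreadP: spS => /(_ _ US).
by exists i; rewrite ?(elt_eq spS US QU).
Qed.

(** * Spreads fixed by the 7-cycle *)

(** The other extended cyclic Hamming code through [Q_1], built on nonsquares instead of squares. *)
Definition base1' : seq bitseq := map (bits_move swap_code) base2.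

Definition sums1 := sums base1.
Definition sums2 := sums base2.
Definition sums1' := sums base1'.
Definition sums3 := sums base3.

(* [bad bs]: the span of [bs] is not totally isotropic, or meets one of the
   first two generators, or meets its images under the 7-cycle. *)
Definition bad (bs : seq bitseq) : bool :=
  let S := sums bs in
  has (fun w => (w != nseq 9 false) &&
    [|| ~~ sing w, w \in sums1, w \in sums2
      | has (fun k => iter k zmove w \in S) (iota 1 6)]) S.

(** A vector of a generator through [Q_1] that is fixed by the 7-cycle lies in one of the two
    Hamming codes. Three shifts suffice, since the shifts by k and 7 - k give the same pairs up to
    the cycle. *)
Lemma check_first : all (fun l => [|| ~~ sing l, l \in sums1, l \in sums1',
    ~~ sing (bits_add l (head l base1))
  | has (fun k => ~~ sing (bits_add l (iter k zmove l))) (iota 1 3)]) (bitseqs 9).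
Proof. by lazy. Qed.

(** Two vectors that each belong to only one of the codes, and not to the same one, cannot lie in a
    common fixed generator; such a generator is therefore contained in a single code. *)
Lemma check_first_mix : all (fun v => all (fun w =>
    [|| v \in sums1', w \in sums1
      | has (fun k => ~~ sing (bits_add v (iter k zmove w))) (iota 0 7)])
  (sums1')) (sums1).
Proof. by lazy. Qed.

Definition orbit_tests : seq bitseq :=
  map block [:: [:: 0; 1; 3; 4]; [:: 0; 1; 4; 6]; [:: 0; 1; 3; 6]]%N.

(* The third generator meets every orbit of the 7-cycle on the points outside
   the first two; a vector outside [base3] is incompatible with a whole orbit. *)
Lemma check_third : all (fun l => [|| bad [:: head l base3; l], l \in sums3
  | has (fun o => all (fun k => bad [:: head l base3; l;
    iter k zmove o]) (iota 0 7)) orbit_tests])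
  (bitseqs 9).
Proof. by lazy. Qed.

Lemma std_gen_len9 i : all len9 (nth [::] bases i).
Proof. by do 9![case: i => [|i] //=]; rewrite nth_nil. Qed.

Lemma mem_base1 v : (v \in gspace base1) = (bits_of v \in sums1).
Proof. exact: mem_gspace. Qed.
Lemma mem_base1' v : (v \in gspace base1') = (bits_of v \in sums1').
Proof. exact: mem_gspace. Qed.
Lemma mem_base2 v : (v \in gspace base2) = (bits_of v \in sums2).
Proof. exact: mem_gspace. Qed.
Lemma mem_base3 v : (v \in gspace base3) = (bits_of v \in sums3).
Proof. exact: mem_gspace. Qed.

Definition zact (v : vec) : vec := col_perm zperm^-1%g v.

Lemma bits_of_zact k v : bits_of (iter k zact v) = iter k zmove (bits_of v).
Proof.
elim: k => //= k <-; rewrite bits_moveE code_zperm; by congr bits_perm.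
Qed.

Lemma bits_of_eq0 v : (bits_of v == nseq 9 false) = (v == 0).
Proof. by rewrite -bits_of0 (inj_eq bits_of_inj). Qed.

Lemma zperm_val k i : val (iter k zperm i) = iter k (nth 0%N (lift_code zc)) i.
Proof. by elim: k => //= k <-; rewrite -nth_code code_zperm. Qed.

Lemma elt_disjoint S i j v :
  spread S -> v \in elt S i -> v \in elt S j -> v != 0 -> i = j.
Proof.
move=> spS vi vj v0; apply: (elt_inj spS).
have [ei _] := mem_elt i spS; have [ej _] := mem_elt j spS.
by by case/spreadP: spS => _ Sd _; apply: (Sd _ _ ei ej v).
Qed.

Lemma gspace1_ti : totally_isotropic (gspace base1).
Proof. by apply: totally_isotropic_gspace; lazy. Qed.

Lemma gspace1'_ti : totally_isotropic (gspace base1').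
Proof. by apply: totally_isotropic_gspace; lazy. Qed.

Lemma gspace3_ti : totally_isotropic (gspace base3).
Proof. by apply: totally_isotropic_gspace; lazy. Qed.

Lemma check_orbit_tests : all (fun o => [&& size o == 9%N, o != nseq 9 false, sing o,
  o \notin sums1 & o \notin sums2]) orbit_tests.
Proof. by lazy. Qed.

Lemma singular_add u v :
  singular (u + v) = sing (bits_add (bits_of u) (bits_of v)).
Proof. by rewrite singular_bits bits_of_add. Qed.

Lemma cover_first v : singular v -> singular (v + Q c1) ->
    (forall k, singular (v + iter k zact v)) ->
  (v \in gspace base1) || (v \in gspace base1').
Proof.
rewrite mem_base1 mem_base1' singular_bits -[_ \in _]/(sing _) singular_add => sv sQ sk.
have /allP/(_ (bits_of v)) := check_first.
rewrite mem_bitseqs size_bits_of sv => /(_ isT).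
rewrite (_ : head _ _ = bits_of (Q c1)); last by rewrite bits_of_Q val_c1.
case/orP=> [//|/orP[h|/orP[h|/orP[h|/hasP[k _]]]]].
- by apply/orP; left.
- by apply/orP; right.
- by rewrite sQ in h.
by rewrite -bits_of_zact -singular_add sk.
Qed.

Lemma mix_first v w : v \in gspace base1 -> w \in gspace base1' ->
    (forall k, singular (v + iter k zact w)) ->
  (v \in gspace base1') || (w \in gspace base1).
Proof.
rewrite !mem_base1 !mem_base1' => v1 w1' sk.
have /allP/(_ _ v1)/allP/(_ _ w1') := check_first_mix.
case/orP=> [h|/orP[h|/hasP[k _]]].
- by apply/orP; left.
- by apply/orP; right.
by rewrite -bits_of_zact -singular_add sk.
Qed.

Lemma first_gen (U : {vspace vec}) : U \in generators -> Q c1 \in U ->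
  perm_space U zperm = U -> U = gspace base1 \/ U = gspace base1'.
Proof.
move: cover_first mix_first gspace1_ti gspace1'_ti.
move: (gspace base1) (gspace base1') => H H' cov mix tH tH'.
case/generatorP=> /totally_isotropicP tU maxU QU zU.
have zk v k : v \in U -> iter k zact v \in U.
  move=> Uv; elim: k => //= k; rewrite -{2}zU mem_perm_space -col_permM mulgV.
  by rewrite col_perm1.
have {}cov v : v \in U -> (v \in H) || (v \in H').
  by move=> Uv; apply: cov => [||k]; rewrite tU ?memvD ?zk.
have [/existsP[v /andP[Uv nv]]|/existsPn UH'] := boolP [exists v,
  (v \in U) && (v \notin H')].
  left; apply/esym/maxU => //; apply/subvP => w Uw.
  have := cov v Uv; rewrite (negbTE nv) orbF => vH.
  case/orP: (cov w Uw) => // wH'; have := mix v w vH wH'.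
  by rewrite (negbTE nv); apply=> k; rewrite tU ?memvD ?zk.
right; apply/esym/maxU => //.
by apply/subvP => w Uw; have := UH' w; rewrite Uw negbK.
Qed.

Lemma elt_zperm S i : spread S -> spread_action S zperm = S ->
  elt S (zperm i) = perm_space (elt S i) zperm.
Proof. by move=> spS zS; rewrite -elt_act // zS. Qed.

Lemma zact_elt S i v k : spread S -> spread_action S zperm = S ->
  v \in elt S i -> iter k zact v \in elt S (iter k zperm i).
Proof.
move=> spS zS vi; elim: k => //= k; rewrite elt_zperm // mem_perm_space.
by rewrite -col_permM mulgV col_perm1.
Qed.

Lemma stab12_zperm : stab12 zperm.
Proof. by rewrite stab12_Gstar ?emb7_Gstar. Qed.

Lemma zperm_c1 : zperm c1 = c1.
Proof. by apply: val_inj; rewrite (zperm_val 1) /= val_c1. Qed.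

Lemma badP bs : bad bs -> exists2 w, w \in sums bs & w != nseq 9 false /\
  [\/ ~~ sing w, w \in sums1, w \in sums2
     | exists2 k, k \in iota 1 6 & iter k zmove w \in sums bs].
Proof.
case/hasP=> w ws /andP[w0 h]; exists w => //; split=> //.
case/orP: h => [h|/orP[h|/orP[h|/hasP[k k6 h]]]]; last by constructor 4; exists k.
- by constructor 1.
- by constructor 2.
- by constructor 3.
Qed.

Lemma third_gen S : spread S -> spread_action S zperm = S ->
  elt S c1 = gspace base1 -> elt S c2 = gspace base2 -> elt S (inord 2) = gspace base3.
Proof.
move=> spS zS e1 e2; set i2 := inord 2; set U := elt S i2.
have v2 : val i2 = 2%N by rewrite /= inordK.
have [US QU] := mem_elt i2 spS; rewrite -/U in US QU.
have /generatorP[/totally_isotropicP tU maxU] : U \in generators.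
  by case/spreadP: spS => /(_ _ US).
have nbad bs : all len9 bs -> all (fun b => vec_of b \in U) bs -> ~~ bad bs.
  move=> lb /allP bU; have subU : (gspace bs <= U)%VS.
    by apply/span_subvP => _ /mapP[b bbs ->]; apply: bU.
  have memU x : x \in sums bs -> vec_of x \in U.
    move=> xS; apply: (subvP subU); rewrite mem_gspace // vec_ofK //.
    exact/eqP/(allP (sums_len9 lb)).
  apply/negP => /badP[w wS]; have /eqP lw := allP (sums_len9 lb) _ wS.
  move=> [w0]; have wU := memU w wS; rewrite -(vec_ofK lw) bits_of_eq0 in w0 *.
  case=> [|w1|w2|[k]].
  - by rewrite -[sing _]singular_bits tU.
  - suff : i2 = c1 by move/(congr1 val); rewrite v2 => /eqP; rewrite [val _]val_c1.
    by apply: (elt_disjoint spS wU _ w0); rewrite e1 mem_base1.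
  - suff : i2 = c2 by move/(congr1 val); rewrite v2 => /eqP; rewrite [val _]val_c2.
    by apply: (elt_disjoint spS wU _ w0); rewrite e2 mem_base2.
  (* Here [U] meets its image under the k-th power of the 7-cycle, which is another element of the
     spread because 0 < k < 7. *)
  rewrite -bits_of_zact mem_iota => /andP[k1 k7] /memU; rewrite bits_ofK => kU.
  have : i2 = iter k zperm i2.
    apply: (elt_disjoint spS kU (zact_elt k spS zS wU)).
    by elim: (k) => //= m; rewrite col_perm_eq0.
  move/(congr1 val); rewrite zperm_val [val i2]v2 -[nat_of_ord i2]/(val i2) [val i2]v2.
  by case: k k1 k7 {kU} => [|[|[|[|[|[|[|k]]]]]]].
have hQ l : head l base3 = bits_of (Q i2) by rewrite bits_of_Q v2.
apply/esym/maxU; first exact: gspace3_ti.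
apply/subvP => v Uv; rewrite mem_base3.
have /allP/(_ (bits_of v)) := check_third.
rewrite mem_bitseqs size_bits_of hQ =>
  /(_ isT)/orP[bad2|/orP[//|/hasP[o ot /allP obad]]].
  apply: contraLR bad2 => _; apply: nbad; first by rewrite /= /len9 !size_bits_of.
  by rewrite /= !bits_ofK QU Uv.
have /allP/(_ o ot)/and5P[/eqP so o0 sgo o1 o2] := check_orbit_tests.
have {}o0 : vec_of o != 0 by rewrite -bits_of_eq0 vec_ofK.
have {}sgo : singular (vec_of o) by rewrite singular_bits vec_ofK.
have {}o1 : vec_of o \notin elt S c1 by rewrite e1 mem_base1 (vec_ofK so); exact: o1.
have {}o2 : vec_of o \notin elt S c2 by rewrite e2 mem_base2 (vec_ofK so); exact: o2.
have [j oj] : exists j, vec_of o \in elt S j.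
  case/spreadP: (spS) => _ _ /(_ _ sgo o0)[W]; rewrite {1}(spreadE spS).
  by case/imsetP=> j _ -> oj; exists j.
(* The element of the spread containing the test point is neither of the first two, so a power of
   the 7-cycle moves it to [U], and with it the point; this contradicts the badness of the whole
   orbit. *)
have [k k7 kj] : exists2 k, (k < 7)%N & iter k zperm j = i2.
  have : j != c1 by apply: contraNneq o1 => <-.
  have : j != c2 by apply: contraNneq o2 => <-.
  rewrite -!val_eqE /= val_c1 val_c2.
  case: j {oj} => [[|[|[|[|[|[|[|[|[|]]]]]]]]] lj] // _ _;
  [exists 0%N|exists 6%N|exists 5%N|exists 4%N|exists 3%N|exists 2%N|exists 1%N] => //;
  by apply: val_inj; rewrite zperm_val v2.
have kt : k \in iota 0 7 by rewrite mem_iota.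
move: (obad k kt); apply: contraLR => _; apply: nbad.
  by rewrite /= -(vec_ofK so) -bits_of_zact /len9 !size_bits_of.
by rewrite /= -(vec_ofK so) -bits_of_zact !bits_ofK QU Uv /U -kj zact_elt.
Qed.

Lemma spread_actM (S : genset) (g h : 'S_9) :
  spread_action S (g * h)%g = spread_action (spread_action S g) h.
Proof. exact: actM. Qed.

Lemma fixed_commute S (g h : 'S_9) : (g * h = h * g)%g ->
  spread_action S h = S -> spread_action (spread_action S g) h = spread_action S g.
Proof. by move=> e hS; rewrite -spread_actM e spread_actM hS. Qed.

Lemma c12_c1 : c12 c1 = c2. Proof. exact: tpermL. Qed.
Lemma c12_c2 : c12 c2 = c1. Proof. exact: tpermR. Qed.

Lemma swap_base2 : perm_space (gspace base2) c12 = gspace base1'.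
Proof. by rewrite perm_gspace code_c12. Qed.

Lemma swap_base1' : perm_space (gspace base1') c12 = gspace base2.
Proof. by rewrite -swap_base2 -perm_spaceM c12K perm_space1. Qed.

Definition meet_word : bitseq := block [:: 2; 5; 7; 8]%N.

Lemma meet_word_neq0 : vec_of meet_word != 0.
Proof. by rewrite -bits_of_eq0 vec_ofK. Qed.

Lemma meet_word1 : vec_of meet_word \in gspace base1.
Proof. by rewrite mem_gspace // vec_ofK //; lazy. Qed.

Lemma meet_word_swap1 : vec_of meet_word \in perm_space (gspace base1) c12.
Proof. by rewrite mem_perm_space_bits // vec_ofK // code_c12; lazy. Qed.

Definition meet_word' : bitseq := block [:: 2; 3; 4; 6]%N.

(** Classifying the generator through [Q_1] both in the spread and in its transposed image leaves
    four cases. In two of them the generators through [Q_1] and [Q_2] share a nonzero vector; the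
    other two are exchanged by the transposition. *)
Lemma first_two S : spread S -> spread_action S zperm = S ->
  exists b : bool, let S' := spread_action S (c12 ^+ b)%g in
    elt S' c1 = gspace base1 /\ elt S' c2 = gspace base2.
Proof.
move=> spS zS.
have inv T i : spread T -> spread_action T zperm = T -> zperm i = i ->
    perm_space (elt T i) zperm = elt T i.
  by move=> spT zT zi; rewrite -elt_zperm // zi.
pose S' := spread_action S c12.
have spS' : spread S' by apply: spread_act.
have zS' : spread_action S' zperm =
  S' by apply: fixed_commute (c12_commute stab12_zperm) zS.
have gen T : spread T -> spread_action T zperm = T ->
    elt T c1 = gspace base1 \/ elt T c1 = gspace base1'.
  move=> spT zT; have [eT QT] := mem_elt c1 spT; apply: first_gen => //.
    by case/spreadP: spT => /(_ _ eT).
  by apply: inv zperm_c1.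
have e1' : elt S' c1 = perm_space (elt S c2) c12 by rewrite -c12_c2 elt_act.
have e2' : elt S' c2 = perm_space (elt S c1) c12 by rewrite -c12_c1 elt_act.
have e2 : elt S c2 = perm_space (elt S' c1) c12.
  by rewrite e1' -perm_spaceM c12K perm_space1.
have [h1|h1] := gen S spS zS; have [h1'|h1'] := gen S' spS' zS'.
- have /eqP[] := c1_neq_c2; apply: (elt_disjoint spS _ _ meet_word_neq0).
    by rewrite h1 meet_word1.
  by rewrite e2 h1' meet_word_swap1.
- by exists false; rewrite /= act1 e2 h1' swap_base1'.
- by exists true; rewrite /= expg1 -/S' h1' e2' h1 swap_base1'.
- have c12w : vec_of meet_word' != 0 by rewrite -bits_of_eq0 vec_ofK.
  have /eqP[] := c1_neq_c2; apply: (elt_disjoint spS _ _ c12w).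
    by rewrite h1 mem_gspace // vec_ofK //; lazy.
  rewrite e2 h1' swap_base1' mem_gspace // vec_ofK //; by lazy.
Qed.

Lemma cinv_zperm : cinv 9 (code zperm) = [:: 0; 1; 8; 2; 3; 4; 5; 6; 7]%N.
Proof. by rewrite code_zperm. Qed.

Lemma z_fixed_spread S : spread S -> spread_action S zperm = S ->
  exists b : bool, spread_action S (c12 ^+ b)%g = std_spread.
Proof.
move=> spS zS; have [b] := first_two spS zS.
set S' := spread_action _ _ => -[e1 e2]; exists b; rewrite -/S'.
have spS' : spread S' by apply: spread_act.
have st : stab12 (c12 ^+ b)%g by apply: stab12X stab12_c12.
have zS' : spread_action S' zperm = S'.
  apply: fixed_commute zS; case: (b) => /=; last by rewrite expg0 mul1g mulg1.
  exact: c12_commute stab12_zperm.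
have e3 := third_gen spS' zS' e1 e2.
rewrite (spreadE spS') /std_spread; apply: eq_imset => i.
have zk k bs : perm_space (gspace bs) (zperm ^+ k)%g = gspace (map (iter k zmove) bs).
  elim: k => [|k IH]; first by rewrite expg0 perm_space1 map_id.
  rewrite expgSr perm_spaceM IH perm_gspace cinv_zperm -map_comp.
  by congr gspace; apply: eq_map.
have eltk k : elt S' (iter k zperm (inord 2)) = gspace (map (iter k zmove) base3).
  rewrite -zk; elim: k => [|k IH]; first by rewrite expg0 perm_space1.
  by rewrite expgSr perm_spaceM -IH -elt_zperm.
have ek k : (k < 7)%N -> iter k zperm (inord 2) = k.+2 :> nat.
  move=> k7; rewrite [nat_of_ord _](zperm_val k) inordK //.
  by case: k k7 => [|[|[|[|[|[|[|]]]]]]].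
rewrite /std_gen; case: i => [[|[|k]] lti].
- by rewrite -e1; congr elt; apply: val_inj; rewrite /= val_c1.
- by rewrite -e2; congr elt; apply: val_inj; rewrite /= val_c2.
have k7 : (k < 7)%N by [].
rewrite -[nat_of_ord (Ordinal lti)]/(k.+2) (_ : Ordinal lti =
  iter k zperm (inord 2)); last by apply: val_inj; rewrite /= ek.
rewrite eltk -[nth [::] bases _]/(nth [::] [seq map (iter j zmove) base3 | j <-
  iota 0 7] k).
by rewrite (nth_map 0%N) ?size_iota // nth_iota.
Qed.

(** * Reduction to the standard spread *)

Lemma order_zperm : #[zperm]%g = 7%N.
Proof.
move: zperm code_zperm => z cz; apply: (@nt_prime_order _ 7) => //.
  by apply: code_inj; rewrite code1 !expgS expg0 mulg1 !code_mul cz.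
by apply: contra_eq_neq cz => ->; rewrite code1.
Qed.

Lemma orbit_z_fixed S : #|orbit spread_action Gstar S| = 120%N ->
  exists2 T, T \in orbit spread_action Gstar S & spread_action T zperm = T.
Proof.
rewrite card_orbit_in ?subsetT // => index_C.
set C := ('C_Gstar[S | spread_action])%G in index_C.
have cG : (#|Gstar| = #|C| * 120)%N by rewrite -index_C Lagrange ?subsetIl.
have zG : zperm \in Gstar by apply: emb7_Gstar.
have sZG : <[zperm]>%g \subset Gstar by rewrite cycle_subG.
have cZ : #|<[zperm]>%g| = 7%N by exact: order_zperm.
(* The 7-part is bounded above by that of 9! and below by the order of [zperm]. *)
have G7 : (#|Gstar|`_7 = 7)%N.
  apply/eqP; rewrite eqn_dvd; apply/andP; split.
    have f7 : ((9`!)`_7 = 7)%N by rewrite p_part !factS !lognM ?muln_gt0 ?fact_gt0.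
    have d : (#|Gstar|`_7 %| (9`!)`_7)%N.
      apply: partn_dvd; first exact: fact_gt0.
      by rewrite -card_Sn -cardsT; apply: cardSg; apply: subsetT.
    by rewrite f7 in d.
  have d : (#|<[zperm]>%g|`_7 %| #|Gstar|`_7)%N.
    by apply: partn_dvd; rewrite ?cardG_gt0 ?cardSg.
  by rewrite cZ part_pnat_id ?pnat_id in d.
have sylZ : (7.-Sylow(Gstar) <[zperm]>)%g by rewrite pHallE sZG cZ G7 /=.
have [P sylP] := Sylow_exists 7 C.
have sylPG : (7.-Sylow(Gstar) P)%g.
  rewrite pHallE (subset_trans (pHall_sub sylP)) ?subsetIl //=.
  rewrite (card_Hall sylP) cG partnM ?cardG_gt0 //.
  by rewrite (_ : 120`_7 = 1)%N ?muln1 // p_part; lazy.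
have [x Gx eZ] := Sylow_trans sylPG sylZ.
have : zperm \in (P :^ x)%g by rewrite -eZ cycle_id.
rewrite mem_conjg => Pz; exists (spread_action S x); first exact: mem_orbit.
have /setIP[_ /astab1P Cz] : (zperm ^ x^-1)%g \in C by apply: (subsetP
  (pHall_sub sylP)).
rewrite -[in RHS]Cz -!spread_actM; congr (spread_action S _).
by rewrite conjgE invgK -!mulgA mulVg mulg1.
Qed.

Lemma orbit_std (Y : {set {vspace vec}}) (X : {set genset}) :
    X \in [set orbit spread_action Gstar S | S in spreads_in Y] -> #|X| = 120%N ->
  exists b : bool,
    [/\ spread std_spread, spread_action std_spread zperm = std_spread
      & X = orbit spread_action Gstar (spread_action std_spread (c12 ^+ b)%g)].
Proof.
case/imsetP=> S; rewrite inE => /andP[spS _] ->{X} cX.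
have [T TS zT] := orbit_z_fixed cX.
have spT : spread T by case/orbitP: TS => g _ <-; apply: spread_act.
have [b eT] := z_fixed_spread spT zT; exists b; split.
- by rewrite -eT spread_act.
- rewrite -eT; apply: fixed_commute zT.
  by case: (b); rewrite ?expg0 ?mul1g ?mulg1 // expg1 c12_commute ?stab12_zperm.
have -> : spread_action std_spread (c12 ^+ b)%g = T.
  rewrite -eT -spread_actM; case: (b); first by rewrite c12K act1.
  by rewrite expg0 mulg1 act1.
by apply/esym/orbit_eqP.
Qed.

(** * The stabiliser of the standard spread *)

(** Multiplication by 3, a primitive root mod 7. *)
Definition mc : seq nat := [:: 0; 3; 6; 2; 5; 1; 4]%N.

Definition affine_code (a b : nat) : seq nat := [seq ((a * k + b) %% 7)%N | k <-
  iota 0 7].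

Definition affine_codes : seq (seq nat) :=
  [seq affine_code a b | a <- iota 1 6, b <- iota 0 7].

Lemma code_tperm n (i j : 'I_n) : code (tperm i j) =
  [seq if k == val i then val j else if k == val j then val i else k | k <- iota 0 n].
Proof.
apply: code_eq => [|k]; first by rewrite size_map size_iota.
rewrite (nth_map 0%N) ?size_iota // nth_iota // permE /= add0n -!val_eqE /=.
by case: eqP => //; case: eqP.
Qed.

Lemma odd_square_code c : wf_code 7 c -> odd_perm (permc 7 (cmul c c)) = false.
Proof.
move=> wf; have -> : permc 7 (cmul c c) = (permc 7 c * permc 7 c)%g.
  by rewrite -[RHS]codeK code_mul permcK.
by rewrite odd_permM addbb.
Qed.

(** Cubing preserves parity, and the cube is multiplication by -1, a product of three disjoint
    transpositions. *)
Lemma odd_mc : odd_perm (permc 7 mc) = true.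
Proof.
set s := permc 7 mc; have : odd_perm (s * s * s)%g = odd_perm s.
  by rewrite !odd_permM addbb.
move=> <-; pose t a b : 'S_7 := tperm (inord a) (inord b).
have -> : (s * s * s = t 1%N 6%N * t 2%N 5%N * t 3%N 4%N)%g.
  by apply: code_inj; rewrite !code_mul permcK // !code_tperm /= !inordK.
by rewrite !odd_permM !odd_tperm -!val_eqE /= !inordK.
Qed.

Lemma code_even c : wf_code 7 c -> odd_perm (permc 7 c) = false ->
  code (emb7 (permc 7 c)) = lift_code c.
Proof. by move=> wf ev; rewrite /emb7 ev mulg1 code_lift_permc. Qed.

Lemma std_gen_act (g : 'S_9) i :
  perm_space (std_gen i) g = gspace (map (bits_move (code g)) (nth [::] bases i)).
Proof. exact: perm_gspace. Qed.

Lemma std_gen_Q (i : 'I_9) : Q i \in std_gen i.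
Proof.
rewrite mem_gspace ?std_gen_len9 // bits_of_Q.
by case: i => [[|[|[|[|[|[|[|[|[|]]]]]]]]]].
Qed.

Lemma gspace_eq bs cs : all len9 bs -> all len9 cs ->
  all (mem (sums cs)) (sums bs) -> all (mem (sums bs)) (sums cs) ->
    gspace bs = gspace cs.
Proof.
move=> lb lc h h'; apply/vspaceP => v; rewrite !mem_gspace //.
apply/idP/idP; first exact: (allP h). exact: (allP h').
Qed.

Definition fixes_std (c : seq nat) : bool :=
  all (fun i => let bs := map (bits_move c) (nth [::] bases i) in
                let cs := nth [::] bases (nth 0%N c i) in
    [&& all len9 bs, all (mem (sums cs)) (sums bs) & all (mem (sums bs)) (sums cs)])
  (iota 0 9).

Lemma fixes_stdP (g : 'S_9) : fixes_std (code g) ->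
  spread_action std_spread g = std_spread.
Proof.
move=> /allP h; have e (i : 'I_9) : perm_space (std_gen i) g = std_gen (g i).
  have := h (val i); rewrite mem_iota ltn_ord => /(_ isT)/and3P[l1 l2 l3].
  by rewrite std_gen_act /std_gen -nth_code; apply: gspace_eq => //;
    apply: std_gen_len9.
apply/setP=> U; apply/imsetP/imsetP => [[_ /imsetP[i _ ->] ->]|[i _ ->]].
  by exists (g i); rewrite //= e.
exists (std_gen (g^-1%g i)); first exact: imset_f.
by rewrite /= e permKV.
Qed.

Lemma fixes_mc : spread_action std_spread (emb7 (permc 7 mc)) = std_spread.
Proof.
apply: fixes_stdP; rewrite /emb7 odd_mc expg1 code_mul code_lift_permc // code_c12.
by lazy.
Qed.

(** Every affine map is a power of the translation followed by a power of multiplication by 3, so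
    invariance of the standard spread has to be known for these two generators only. *)
Lemma affine_codesE : all (fun c => c \in
    [seq iter j (cmul zc) (iter i (cmul mc) (iota 0 7)) | i <- iota 0 6, j <- iota 0 7])
  affine_codes.
Proof. by lazy. Qed.

Lemma code_iter_mul n (s t : 'S_n) k :
  code (iter k (mulg s) t) = iter k (cmul (code s)) (code t).
Proof. by elim: k => //= k <-; rewrite code_mul. Qed.

Lemma fixes_affine c : spread_action std_spread zperm = std_spread ->
  c \in affine_codes -> spread_action std_spread (emb7 (permc 7 c)) = std_spread.
Proof.
move=> fz /(allP affine_codesE)/allpairsP[[i j] [_ _ ->]];
  rewrite -[(i, j).1]/i -[(i, j).2]/j.
rewrite -(code1 7) -[mc](@permcK 7) // -[zc](@permcK 7) // -!code_iter_mul codeK.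
elim: j => [|j IHj]; last by rewrite iterS emb7M spread_actM fz.
elim: i => [|i IHi]; last by rewrite iterS emb7M spread_actM fixes_mc.
by rewrite /= emb7_1 act1.
Qed.

(** * Intersection dimensions *)

(** The element of the moved spread through [Q_j] is the image of the standard one whose index is
    the preimage of [j], that is, [index j c]. *)
Definition moved_base (c : seq nat) (j : nat) : seq bitseq :=
  map (bits_move c) (nth [::] bases (index j c)).

Definition common (c : seq nat) (i j : nat) : nat :=
  count (mem (sums (moved_base c j))) (sums (nth [::] bases i)).

(** The logarithm to base 2; other arguments give the meaningless value 5, which [mdim_ok]
    excludes. *)
Definition dim_of_card (n : nat) : nat := index n [:: 1; 2; 4; 8; 16]%N.

Definition mdim (c : seq nat) (i j : nat) : nat := dim_of_card (common c i j).

Definition mdim_ok (c : seq nat) (i j : nat) : bool :=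
  all len9 (moved_base c j) && (common c i j \in [:: 1; 2; 4; 8; 16]%N).

Lemma uniq_sums_bases : all (fun bs => uniq (sums bs)) bases.
Proof. by lazy. Qed.

Lemma meet_dim_std (g : 'S_9) (i j : 'I_9) : spread std_spread ->
    mdim_ok (code g) i j ->
  meet_dim std_spread (spread_action std_spread g) i j = mdim (code g) i j.
Proof.
move=> spS /andP[lm cm].
have elt_std k : elt std_spread k = std_gen k.
  by apply: elt_eq; rewrite ?std_gen_Q ?imset_f.
rewrite /meet_dim -[j in LHS](permKV g) elt_act // !elt_std std_gen_act.
have ej : index (val j) (code g) = g^-1%g j.
  rewrite (_ : val j = nth 0%N (code g) (g^-1%g j)); last by rewrite nth_code permKV.
  rewrite index_uniq ?size_code //.
  by rewrite map_inj_uniq ?enum_uniq // => k l /val_inj/perm_inj.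
rewrite -ej; apply: dim_gspaceI; rewrite ?std_gen_len9 //.
  by apply: (allP uniq_sums_bases); rewrite mem_nth.
rewrite -/(moved_base _ _) -/(common _ _ _) /mdim; move: (common _ _ _) cm => n.
by rewrite !inE => /or4P[/eqP->|/eqP->|/eqP->|/orP[]/eqP->].
Qed.

(** * The 120 spreads *)

Definition codes : seq (seq nat) :=
  [seq [:: 0, 1 & p]%N | p <- permutations (iota 2 5)].

(** The rank of an arrangement of distinct numbers in lexicographic order. *)
Fixpoint lehmer (s : seq nat) : nat :=
  if s is a :: s' then (count (fun b => b < a) s' * (size s')`! + lehmer s')%N else 0%N.

(* The entry at position [lehmer p] is the index of the relation that contains
   the pair of the standard spread and its image under the permutation [0, 1 & p]. *)
Definition class_table : seq nat :=
  [:: 0; 4; 4; 5; 5; 4; 4; 3; 5; 3; 3; 6; 5; 3; 4; 6; 1; 2; 3; 6; 6; 4; 2; 4; 4;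
      1; 3; 5; 5; 2; 5; 5; 3; 5; 3; 5; 3; 6; 6; 2; 4; 4; 3; 5; 3; 5; 5; 6; 5; 5;
      3; 3; 6; 5; 4; 2; 6; 5; 5; 5; 1; 4; 2; 4; 1; 2; 4; 2; 5; 5; 5; 5; 3; 3; 6;
      3; 4; 5; 6; 5; 4; 5; 2; 5; 2; 5; 4; 6; 5; 5; 1; 5; 5; 3; 3; 3; 5; 5; 2; 5;
      4; 6; 5; 5; 5; 4; 5; 2; 4; 5; 6; 2; 3; 1; 2; 5; 5; 1; 3; 4]%N.

Definition rel_class (c : seq nat) : nat := nth 0%N class_table (lehmer (drop 2 c)).

Definition rep_roots : seq (seq nat) :=
  [:: [:: 0; 1; 2; 3; 4; 5; 6]; [:: 0; 1; 2; 4; 5; 6; 3]; [:: 0; 1; 3; 4; 6; 5; 2];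
      [:: 0; 1; 2; 5; 6; 4; 3]; [:: 0; 1; 2; 4; 6; 3; 5]; [:: 0; 1; 2; 3; 5; 6; 4];
      [:: 0; 1; 2; 4; 6; 5; 3]]%N.

(* Squares, hence even: [emb7] does not swap the first two coordinates. *)
Definition reps : seq (seq nat) := [seq cmul c c | c <- rep_roots].
Definition rep (k : nat) : seq nat := nth [::] reps k.

Lemma size_codes : size codes = 120%N. Proof. by lazy. Qed.
Lemma uniq_codes : uniq codes.
Proof.
rewrite map_inj_uniq ?permutations_uniq // => p q [].
by [].
Qed.

Definition invs (c : seq nat) : int * nat :=
  ((mdim c 0 1 + mdim c 1 0)%:Z - 2,
   count (fun i => (mdim c 0 i == 2) && (mdim c 1 i == 2))%N (iota 2 7)).

(** The only place where the invariants are evaluated. The condition [mdim c 0 0 != 4] says that the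
    generator through [Q_1] changes, hence that the two spreads are distinct. *)
Lemma check_reps : all (fun k => let c := lift_code (rep k) in
    [&& all (mdim_ok c 0) (iota 0 9), all (mdim_ok c 1) (iota 0 9),
        mdim c 0 0 != 4%N & invs c == nth (0, 0%N) inv_table k.-1])
  (iota 1 6).
Proof. by lazy. Qed.

(** The code lies in the same double coset of the affine group as its representative; the witness
    [h] fixes the base spread and carries one image to the other. *)
Lemma check_orbits : all (fun c => let d := cinv 7 c in
    has (fun h => cmul (cmul (rep (rel_class c)) h) d \in affine_codes) affine_codes)
  codes.
Proof. by lazy. Qed.

Lemma check_class : all (fun c =>
  (rel_class c < 7)%N && ((rel_class c == 0%N) == (c == iota 0 7))) codes.
Proof. by lazy. Qed.

Lemma check_class_inv : all (fun c => rel_class (cinv 7 c) == rel_class c) codes.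
Proof. by lazy. Qed.

Lemma check_rep : all (fun k =>
  (rep k \in codes) && (rel_class (rep k) == k)) (iota 0 7).
Proof. by lazy. Qed.

(** Distinct spreads whose invariants are not in the table get the value 7, which is no relation. *)
Definition ridx (x y : genset) : nat :=
  if x == y then 0%N else (index (Inv1 x y, Inv2 x y) inv_table).+1.

Lemma mem_Rel (X : {set genset}) (i : 'I_7) x y :
  ((x, y) \in Rel X i) = [&& x \in X, y \in X & ridx x y == i].
Proof.
rewrite /Rel /ridx; case: eqVneq => [->|i0].
  by rewrite !inE /= -andbA; case: (x == y).
rewrite !inE -andbA -[(x, y).1]/x -[(x, y).2]/y; do 2!congr (_ && _); case: (x == y).
  by apply/esym/negbTE; rewrite (eq_sym 0%N); exact: i0.
case: i i0 => [[|i] lti] i0; first by case/negP: i0.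
rewrite -[nat_of_ord _]/(i.+1) eqSS -[i.+1.-1]/i.
have lt_i6 : (i < size inv_table)%N by [].
apply/eqP/eqP => [->|e]; first by rewrite index_uniq.
by move: lt_i6; rewrite -e index_mem => /nth_index->.
Qed.

Lemma meet_dim_std_id : spread std_spread -> meet_dim std_spread std_spread c1 c1 = 4%N.
Proof.
by move=> spS; rewrite -[X in meet_dim _ X](act1 spread_action) meet_dim_std //
  code1 val_c1 //.
Qed.

Lemma rep_wf k : (k < 7)%N -> wf_code 7 (rep k).
Proof.
have /allP h : all (fun j => wf_code 7 (rep j)) (iota 0 7) by lazy.
by move=> k7; apply: h; rewrite mem_iota.
Qed.

Lemma rep_even k : (k < 7)%N -> odd_perm (permc 7 (rep k)) = false.
Proof.
move=> k7; rewrite /rep (nth_map [::]) // odd_square_code //.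
have /allP : all (wf_code 7) rep_roots by lazy.
by apply; rewrite mem_nth.
Qed.

Section Orbit.

Variable b : bool.
Hypothesis spread_std : spread std_spread.
Hypothesis zfix : spread_action std_spread zperm = std_spread.

Definition base_spread : genset := spread_action std_spread (c12 ^+ b)%g.
Definition pt (s : 'S_7) : genset := spread_action base_spread (emb7 s).

Lemma stab12_c12b : stab12 (c12 ^+ b)%g.
Proof. exact: stab12X stab12_c12. Qed.

Lemma c12b_commute g : stab12 g -> (c12 ^+ b * g = g * c12 ^+ b)%g.
Proof. by move=> st; case: b; rewrite ?expg0 ?mul1g ?mulg1 // expg1 c12_commute. Qed.

(** With the transposition moved to the end, invariants can be computed from the standard spread
    whatever [b] is. *)
Lemma ptE s : pt s = spread_action (spread_action std_spread (emb7 s)) (c12 ^+ b)%g.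
Proof.
by rewrite /pt /base_spread -!spread_actM c12b_commute // stab12_Gstar ?emb7_Gstar.
Qed.

Lemma spread_pt s : spread (pt s).
Proof. by rewrite /pt !spread_act. Qed.

Lemma pt1 : pt 1 = base_spread.
Proof. by rewrite /pt emb7_1 act1. Qed.

Lemma ptM s t : pt (s * t)%g = spread_action (pt s) (emb7 t).
Proof. by rewrite /pt emb7M spread_actM. Qed.

Lemma pt_affine c s : c \in affine_codes -> pt (permc 7 c * s)%g = pt s.
Proof. by move=> ac; rewrite !ptE emb7M spread_actM fixes_affine. Qed.

Lemma ridx_act g x y : stab12 g -> spread x -> spread y ->
  ridx (spread_action x g) (spread_action y g) = ridx x y.
Proof.
move=> st spx spy; rewrite /ridx (inj_eq (act_inj _ _)).
by rewrite (Inv1_act st spx spy) (Inv2_act st spx spy).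
Qed.

Lemma ridx_rep k : (k < 7)%N -> ridx base_spread (pt (permc 7 (rep k))) = k.
Proof.
case: k => [_|k lt_k];
  first by rewrite -[permc 7 _]/(permc 7 (iota 0 7)) -(code1 7) codeK pt1 /ridx eqxx.
have /allP/(_ k.+1) := check_reps;
  rewrite mem_iota lt_k => /(_ isT)/and4P[/allP m0 /allP m1 d0 /eqP ik].
rewrite ptE ridx_act ?stab12_c12b ?spread_act // /ridx.
set g := emb7 _; have cg : code g = lift_code (rep k.+1).
  by rewrite /g code_even ?rep_wf ?rep_even.
have m0' (i : 'I_9) : mdim_ok (code g) c1 i by rewrite cg val_c1; apply: m0;
  rewrite mem_iota ltn_ord.
have m1' (i : 'I_9) : mdim_ok (code g) c2 i by rewrite cg val_c2; apply: m1;
  rewrite mem_iota ltn_ord.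
have ne : std_spread != spread_action std_spread g.
  apply: contraNneq d0 => e; have := meet_dim_std spread_std (m0' c1).
  by rewrite -e meet_dim_std_id // val_c1 cg => <-.
rewrite (negbTE ne) Inv1E Inv2E ?spread_act //; congr _.+1.
have -> : #|[set i | [&& i \notin [set c1; c2],
      meet_dim std_spread (spread_action std_spread g) c1 i == 2
    & meet_dim std_spread (spread_action std_spread g) c2 i == 2]]%N|
  = count (fun i => (mdim (code g) 0 i == 2) && (mdim (code g) 1 i == 2))%N (iota 2 7).
  have -> : iota 2 7 = filter (leq 2) (map val (enum 'I_9)).
    by rewrite val_enum_ord.
  rewrite count_filter count_map cardE -size_filter /enum_mem -filter_predI.
  congr size; apply: eq_filter => i; rewrite /= !inE andbT.
  rewrite !meet_dim_std // val_c1 val_c2 andbC; congr (_ && _).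
  by rewrite -!val_eqE /= val_c1 val_c2; case: i => [[|[|i]]].
rewrite !meet_dim_std // val_c1 val_c2 cg -/(invs _) ik.
by rewrite index_uniq.
Qed.

End Orbit.

Lemma wf_code_perm n (s : 'S_n) : wf_code n (code s).
Proof.
rewrite /wf_code size_code eqxx map_inj_uniq ?enum_uniq ?andbT /=; last first.
  by move=> j k /val_inj/perm_inj.
by apply/allP => _ /mapP[j _ ->] /=.
Qed.

Lemma codes_sub : all (fun c =>
  [&& wf_code 7 c, nth 0%N c 0 == 0%N & nth 0%N c 1 == 1%N]) codes.
Proof. by lazy. Qed.

Lemma codes_sup p : wf_code 7 [:: 0, 1 & p]%N -> [:: 0, 1 & p]%N \in codes.
Proof.
case/and3P=> /eqP[sp] /= lp; rewrite inE negb_or => /and3P[p0 p1 up].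
rewrite /codes; apply: (map_f (fun q => [:: 0, 1 & q]%N)).
rewrite mem_permutations; apply: uniq_perm => //.
have sub : {subset p <= iota 2 5}.
  move=> k kp; rewrite mem_iota (allP lp) // andbT.
  by case: k kp => [|[|//]] kp; rewrite kp in p0 p1.
have [] := uniq_min_size up sub; by rewrite ?size_iota ?sp.
Qed.

Lemma mem_codes (s : 'S_7) :
  (code s \in codes) = (s (inord 0) == inord 0) && (s (inord 1) == inord 1).
Proof.
have e k : (k < 7)%N -> (s (inord k) == inord k) = (nth 0%N (code s) k == k).
  by move=> k7; rewrite -val_eqE /= inordK // -[k in nth _ _ k](@inordK 6) // nth_code.
rewrite !e //; apply/idP/idP => [/(allP codes_sub)/and3P[_ -> ->] //|].
case: (code s) (wf_code_perm s) => [|i [|j p]] // wf /andP[/eqP/= ei /eqP/= ej].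
by move: wf; rewrite ei ej; apply: codes_sup.
Qed.

Lemma codesM (s t : 'S_7) : code s \in codes -> code t \in codes ->
  code (s * t)%g \in codes.
Proof.
rewrite !mem_codes => /andP[/eqP s0 /eqP s1] /andP[/eqP t0 /eqP t1].
by rewrite !permM s0 s1 t0 t1 !eqxx.
Qed.

Lemma codesV (s : 'S_7) : code s \in codes -> code s^-1%g \in codes.
Proof.
have e i : s i = i -> s^-1%g i = i by move=> si; rewrite -{1}si permK.
by rewrite !mem_codes => /andP[/eqP/e-> /eqP/e->]; rewrite !eqxx.
Qed.

Lemma codes_wf c : c \in codes -> wf_code 7 c.
Proof. by move/(allP codes_sub)/and3P=> []. Qed.

Lemma affine_wf c : c \in affine_codes -> wf_code 7 c.
Proof.
have /allP h : all (wf_code 7) affine_codes by lazy.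
exact: h.
Qed.

Lemma class_lt c : c \in codes -> (rel_class c < 7)%N.
Proof. by move/(allP check_class)/andP=> []. Qed.

Lemma class_eq0 c : c \in codes -> (rel_class c == 0%N) = (c == iota 0 7).
Proof. by move/(allP check_class)/andP=> [_ /eqP]. Qed.

Lemma rep_in k : (k < 7)%N -> rep k \in codes /\ rel_class (rep k) = k.
Proof.
move=> k7; have /allP/(_ k) := check_rep; rewrite mem_iota => /(_ k7)/andP[].
by move=> rk /eqP.
Qed.

(** * The parametrisation of the orbit by the 120 codes *)

Section Points.

Variable b : bool.
Hypothesis spread_std : spread std_spread.
Hypothesis zfix : spread_action std_spread zperm = std_spread.

Local Notation base := (base_spread b).
Local Notation pt := (pt b).

Lemma orbit_rep s : code s \in codes ->
  exists2 g, g \in Gstar & spread_action base g = base /\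
    spread_action (pt (permc 7 (rep (rel_class (code s))))) g = pt s.
Proof.
move=> cs; set r := rep _; have /hasP[h ah aff] := allP check_orbits _ cs.
have wr : wf_code 7 r by apply: rep_wf; apply: class_lt.
exists (emb7 (permc 7 h)); first exact: emb7_Gstar.
split; first by rewrite -/(pt _) -[permc 7 h]mulg1 pt_affine // pt1.
rewrite -ptM; set a := cmul _ _ in aff.
suff -> : (permc 7 r * permc 7 h = permc 7 a * s)%g by rewrite pt_affine.
apply: (mulIg s^-1%g); rewrite mulgK.
by apply: code_inj; rewrite !code_mul code_inv (permcK wr) (permcK (affine_wf
  ah)) (permcK (affine_wf aff)).
Qed.

Lemma ridx_base s : code s \in codes -> ridx base (pt s) = rel_class (code s).
Proof.
move=> cs; have [g Gg [gb gr]] := orbit_rep cs.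
have spb : spread base by rewrite -pt1 spread_pt.
rewrite -gr -{1}gb ridx_act ?stab12_Gstar ?spread_pt //.
by rewrite ridx_rep // class_lt.
Qed.

Lemma ridx_pt s t : code s \in codes -> code t \in codes ->
  ridx (pt s) (pt t) = rel_class (cmul (code t) (cinv 7 (code s))).
Proof.
move=> cs ct; have spb : spread base by rewrite -pt1 spread_pt.
rewrite -[X in ridx _ (pt X)](mulgKV s) ptM -[pt s]/(spread_action base (emb7 s)).
rewrite ridx_act ?stab12_Gstar ?emb7_Gstar ?spread_pt // ridx_base ?codesM ?codesV //.
by rewrite code_mul code_inv.
Qed.

Lemma ridx_eq0 x y : (ridx x y == 0%N) = (x == y).
Proof. by rewrite /ridx; case: (x == y). Qed.

(** Equal spreads have index 0, and among the codes only the identity has class 0. *)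
Lemma pt_inj s t : code s \in codes -> code t \in codes -> pt s = pt t -> s = t.
Proof.
move=> cs ct e; have := ridx_pt cs ct; rewrite e => /esym/eqP.
have /eqP-> : ridx (pt t) (pt t) == 0%N by rewrite ridx_eq0.
rewrite -code_inv -code_mul class_eq0 ?codesM ?codesV // -(code1 7) =>
  /eqP/code_inj ets.
by rewrite -[t](mulgKV s) ets mul1g.
Qed.

Definition points120 : seq genset := [seq pt (permc 7 c) | c <- codes].

Lemma uniq_points : uniq points120.
Proof.
rewrite map_inj_in_uniq ?uniq_codes // => c d cc cd.
have e x : x \in codes -> code (permc 7 x) = x by move/codes_wf/permcK.
by move/pt_inj; rewrite !e // => /(_ cc cd)/(congr1 (@code 7)); rewrite !e.
Qed.

Variable X : {set genset}.
Hypothesis orbX : X = orbit spread_action Gstar base.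
Hypothesis cardX : #|X| = 120%N.

Lemma pt_X s : pt s \in X.
Proof. by rewrite orbX mem_orbit ?emb7_Gstar. Qed.

Lemma mem_points : X =i points120.
Proof.
have sub : {subset points120 <= enum X} by move=> _ /mapP[c _ ->];
  rewrite mem_enum pt_X.
have [|_ e] := uniq_min_size uniq_points sub.
  by rewrite -cardE cardX size_map size_codes.
by move=> x; rewrite e mem_enum.
Qed.

Lemma X_pt x : x \in X -> exists2 s, code s \in codes & x = pt s.
Proof.
rewrite mem_points => /mapP[c cc ->]; exists (permc 7 c) => //.
by rewrite permcK ?codes_wf.
Qed.

Lemma spread_X x : x \in X -> spread x.
Proof. by case/X_pt => s _ ->; apply: spread_pt. Qed.

Lemma act_X x g : g \in Gstar -> (spread_action x g \in X) = (x \in X).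
Proof. by move=> Gg; rewrite orbX -!orbit_eq_mem orbit_act. Qed.

Lemma to_rep x y : x \in X -> y \in X ->
  exists2 g, g \in Gstar & spread_action base g = x /\
    spread_action (pt (permc 7 (rep (ridx x y)))) g = y.
Proof.
move=> Xx Xy; have spx := spread_X Xx; have spy := spread_X Xy.
have spb : spread base by rewrite -pt1 spread_pt.
have /orbitP[g Gg gx] : x \in orbit spread_action Gstar base by rewrite -orbX.
have /X_pt[s cs es] : spread_action y g^-1%g \in X by rewrite act_X ?groupV.
have [h Gh [hb hr]] := orbit_rep cs; exists (h * g)%g; first exact: groupM.
have -> : ridx x y = rel_class (code s).
  transitivity (ridx base (pt s)); last exact: ridx_base.
  rewrite -es -(ridx_act (stab12_Gstar (groupVr Gg)) spx spy).
  by congr ridx; rewrite -gx -spread_actM mulgV act1.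
by rewrite !spread_actM hb hr -es -spread_actM mulVg act1.
Qed.

(** Both pairs are images of the base spread paired with the representative of their common
    relation. *)
Lemma ridx_orbital x y x' y' : x \in X -> y \in X -> x' \in X -> y' \in X ->
    ridx x y = ridx x' y' ->
  exists2 g, g \in Gstar & spread_action x g = x' /\ spread_action y g = y'.
Proof.
move=> Xx Xy Xx' Xy' e; have [g Gg [gx gy]] := to_rep Xx Xy.
have := to_rep Xx' Xy'; rewrite -e => -[h Gh [hx hy]].
exists (g^-1 * h)%g; first by rewrite groupM ?groupV.
split; [rewrite -gx|rewrite -gy]; rewrite -spread_actM mulKVg; [exact: hx|exact: hy].
Qed.

Lemma ridx_mono x y g : g \in Gstar -> x \in X -> y \in X ->
  ridx (spread_action x g) (spread_action y g) = ridx x y.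
Proof. by move=> /stab12_Gstar st /spread_X spx /spread_X; apply: ridx_act. Qed.

End Points.

Definition cdiv (d c : seq nat) : seq nat := cmul d (cinv 7 c).

Lemma codes_div c d : c \in codes -> d \in codes -> cdiv d c \in codes.
Proof.
move=> cc cd; rewrite /cdiv -(permcK (codes_wf cc)) -(permcK (codes_wf cd)).
by rewrite -code_inv -code_mul codesM ?codesV // permcK ?codes_wf.
Qed.

Definition id_code : seq nat := iota 0 7.

Lemma cinv_div c d : c \in codes -> d \in codes -> cinv 7 (cdiv d c) = cdiv c d.
Proof.
move=> cc cd; rewrite /cdiv -(permcK (codes_wf cc)) -(permcK (codes_wf cd)).
by rewrite -!code_inv -!code_mul -code_inv invMg invgK.
Qed.

Lemma id_in_codes : id_code \in codes.
Proof. by case: (rep_in (isT : 0 < 7)%N). Qed.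

Lemma cdiv_id c : c \in codes -> cdiv c id_code = c.
Proof.
have /allP h : all (fun d => cdiv d id_code == d) codes by lazy.
by move/h/eqP.
Qed.

Lemma cdiv_eq_id c d : c \in codes -> d \in codes -> (cdiv d c == id_code) = (d == c).
Proof.
move=> cc cd; rewrite /cdiv /id_code -(permcK (codes_wf cc)) -(permcK (codes_wf cd)).
rewrite -code_inv -code_mul -(code1 7) !(inj_eq (@code_inj 7)).
by rewrite -eq_mulgV1.
Qed.

(** Valency and common neighbours are counted at the base point and for one pair in each relation;
    transitivity on each relation extends this to all pairs. *)
Definition srg_mask (m : nat -> bool) : bool :=
  (count (fun c => m (rel_class c)) codes == 56%N) &&
  all (fun k => count (fun c => m (rel_class c) && m (rel_class (cdiv (rep k) c))) codes
       == if m k then 28%N else 24%N) (iota 1 6).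

Definition mask56 : bitseq := [:: false; false; false; false; true; true].
Definition mask346 : bitseq := [:: false; false; true; true; false; true].

Lemma check_srg : all (fun l => srg_mask (nth false (false :: l)) ==
  ((l == mask56) || (l == mask346))) (bitseqs 6).
Proof. by lazy. Qed.

(** Only the 64 unions without the identity relation are encoded, hence the [false] put in front
    when a mask is indexed by relations. *)
Definition mask (I : {set 'I_7}) : bitseq := [seq inord k \in I | k <- iota 1 6].

Lemma nth_mask (I : {set 'I_7}) (i : 'I_7) : ord0 \notin I ->
  nth false (false :: mask I) i = (i \in I).
Proof.
case: i => [[|k] ltk] nI; first by apply/esym/negbTE;
  rewrite (_ : Ordinal _ = ord0) //; apply: val_inj.
rewrite /= (nth_map 0%N) ?size_iota // nth_iota // add1n.
by rewrite (_ : inord k.+1 = Ordinal ltk) //; apply: val_inj; rewrite /= inordK.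
Qed.

Lemma mask_inj (I J : {set 'I_7}) : ord0 \notin I -> ord0 \notin J ->
  mask I = mask J -> I = J.
Proof. by move=> nI nJ e; apply/setP => i;
  rewrite -(nth_mask i nI) -(nth_mask i nJ) e. Qed.

Lemma mask_I56 : mask I56 = mask56.
Proof. by rewrite /mask /= !inE -!val_eqE /= !inordK. Qed.

Lemma mask_I346 : mask I346 = mask346.
Proof. by rewrite /mask /= !inE -!val_eqE /= !inordK. Qed.

Lemma notin_I56 : ord0 \notin I56.
Proof. by rewrite !inE -!val_eqE /= !inordK. Qed.

Lemma notin_I346 : ord0 \notin I346.
Proof. by rewrite !inE -!val_eqE /= !inordK. Qed.

(** * Combinatorics of the relations *)

Section Model.

Opaque codes rel_class rep cdiv.

Variables (T : finType) (X : {set T}) (gT : finGroupType) (G : {group gT}).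
Variables (to : {action gT &-> T}) (r : T -> T -> nat) (pts : seq nat -> T).
Hypothesis uniq_pts : uniq [seq pts c | c <- codes].
Hypothesis mem_pts : X =i [seq pts c | c <- codes].
Hypothesis r_pts : {in codes &, forall c d, r (pts c) (pts d) = rel_class (cdiv d c)}.
Hypothesis act_X : forall x g, g \in G -> (to x g \in X) = (x \in X).
Hypothesis r_mono : forall x y g, g \in G -> x \in X -> y \in X ->
  r (to x g) (to y g) = r x y.
Hypothesis r_orbital : forall x y x' y', x \in X -> y \in X -> x' \in X -> y' \in X ->
    r x y = r x' y' ->
  exists2 g, g \in G & to x g = x' /\ to y g = y'.

Lemma pts_in c : c \in codes -> pts c \in X.
Proof. by move=> cc; rewrite mem_pts map_f. Qed.

Lemma ptsP x : x \in X -> exists2 c, c \in codes & x = pts c.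
Proof. by rewrite mem_pts => /mapP. Qed.

Lemma r_lt7 x y : x \in X -> y \in X -> (r x y < 7)%N.
Proof.
move=> /ptsP[c cc ->] /ptsP[d cd ->]; rewrite r_pts //.
exact/class_lt/codes_div.
Qed.

Lemma rC x y : x \in X -> y \in X -> r y x = r x y.
Proof.
move=> /ptsP[c cc ->] /ptsP[d cd ->]; rewrite !r_pts //.
by rewrite -(eqP (allP check_class_inv _ (codes_div cc cd))) cinv_div.
Qed.

Lemma cardX : #|X| = 120%N.
Proof. by rewrite (eq_card mem_pts) (card_uniqP uniq_pts) size_map;
  exact: size_codes. Qed.

Lemma count_X (P : pred T) :
  #|[set z in X | P z]| = count (fun c => P (pts c)) codes.
Proof.
rewrite -(count_map pts) -size_filter -(card_uniqP (filter_uniq P uniq_pts)).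
by apply: eq_card => z; rewrite !inE mem_filter mem_pts andbC.
Qed.

Lemma r_id c : c \in codes -> r (pts id_code) (pts c) = rel_class c.
Proof. by move=> cc; rewrite r_pts ?id_in_codes // cdiv_id. Qed.

Lemma to_rep_pts x y : x \in X -> y \in X ->
  exists2 g, g \in G & to (pts id_code) g = x /\
    to (pts (rep (r x y))) g = y.
Proof.
move=> Xx Xy; have [rc rk] := rep_in (r_lt7 Xx Xy).
apply: r_orbital (pts_in id_in_codes) (pts_in rc) Xx Xy _.
by rewrite (r_id rc) rk.
Qed.

(** A group element takes the standard pair in the same relation to (x, y) and matches the sets that
    are counted. Choices of [q] give valencies, common neighbours and intersection numbers alike. *)
Lemma count_rel (q : nat -> nat -> bool) x y : x \in X -> y \in X ->
  #|[set z in X | q (r x z) (r z y)]| =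
    count (fun c => q (rel_class c) (rel_class (cdiv (rep (r x y)) c))) codes.
Proof.
move=> Xx Xy; have [g Gg [gx gy]] := to_rep_pts Xx Xy.
have [rc _] := rep_in (r_lt7 Xx Xy).
set d := rep _ in gy rc *; rewrite -gx -gy.
have -> : #|[set z in X | q (r (to (pts id_code) g) z)
                            (r z (to (pts d) g))]| =
          #|[set z in X | q (r (pts id_code) z) (r z (pts d))]|.
  rewrite -[RHS](card_imset _ (act_inj to g)); apply: eq_card => z.
  apply/idP/imsetP => [|[t ht ->]]; last first.
    by move: ht; rewrite !inE act_X // => /andP[Xt qt];
      rewrite Xt !r_mono ?pts_in ?id_in_codes.
  rewrite inE => /andP[Xz qz].
    exists (to z g^-1%g); last by rewrite -actM mulVg act1.
    have Xz' : to z g^-1%g \in X by rewrite act_X ?groupV.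
    rewrite inE Xz' -(r_mono Gg) ?pts_in ?id_in_codes //.
    by rewrite -(r_mono Gg Xz') ?pts_in // -!actM mulVg act1.
rewrite count_X; apply: eq_in_count => c cc.
by rewrite r_id // r_pts.
Qed.

Lemma orbitalE x y : x \in X -> y \in X ->
  orbital G to (x, y) =
    [set p in setX X X | r p.1 p.2 == r x y].
Proof.
move=> Xx Xy; apply/setP => -[x' y']; rewrite !inE /=;
  apply/imsetP/idP => [[g Gg [-> ->]]|].
  by rewrite !act_X // Xx Xy r_mono // eqxx.
case/andP=> /andP[Xx' Xy'] /eqP/esym e.
by have [g Gg [gx gy]] := r_orbital Xx Xy Xx' Xy' e; exists g; rewrite ?gx ?gy.
Qed.

Definition rel_set (i : 'I_7) : {set T * T} := [set p in setX X X | r p.1 p.2 == i].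

Lemma mem_rel_set (i : 'I_7) x y :
  ((x, y) \in rel_set i) = [&& x \in X, y \in X & r x y == i].
Proof. by rewrite !inE -andbA. Qed.

Lemma generously_transitive_X : generously_transitive X G to.
Proof.
move=> x y Xx Xy; have [g Gg [gx gy]] := r_orbital Xx Xy Xy Xx (esym (rC Xx Xy)).
by exists g.
Qed.

Lemma rel_set_rep (i : 'I_7) : (pts id_code, pts (rep i)) \in rel_set i.
Proof.
have [rc ri] := rep_in (ltn_ord i).
by rewrite mem_rel_set !pts_in ?id_in_codes //= r_id // ri.
Qed.

Lemma rel_set_inj : injective (rel_set).
Proof.
move=> i j e; apply: val_inj; have := rel_set_rep i; rewrite e mem_rel_set.
have [rc ri] := rep_in (ltn_ord i); rewrite r_id // ri.
by case/and3P=> _ _ /eqP.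
Qed.

Lemma rel_set_orbitals : [set rel_set i | i : 'I_7] = orbitals X G to.
Proof.
apply/setP => E; apply/imsetP/imsetP => [[i _ ->]|[[x y]]].
  have [rc ri] := rep_in (ltn_ord i).
  exists (pts id_code, pts (rep i)); first by rewrite inE !pts_in ?id_in_codes.
  by rewrite orbitalE ?pts_in ?id_in_codes // r_id // ri /rel_set.
rewrite inE => /andP[Xx Xy] ->; exists (Ordinal (r_lt7 Xx Xy)) => //.
by rewrite orbitalE.
Qed.

Section Unions.

Variable I : {set 'I_7}.
Hypothesis nI : ord0 \notin I.

Definition union_set : {set T * T} := \bigcup_(i in I) rel_set i.
Let m := nth false (false :: mask I).

Lemma mem_union x y : ((x, y) \in union_set) = [&& x \in X, y \in X & m (r x y)].
Proof.
apply/bigcupP/and3P => [[i Ii]|[Xx Xy mr]].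
  by rewrite mem_rel_set => /and3P[-> -> /eqP->]; rewrite /m nth_mask.
exists (Ordinal (r_lt7 Xx Xy)); last by rewrite mem_rel_set Xx Xy /=.
by rewrite -nth_mask.
Qed.

Lemma nbrs_union x : x \in X -> nbrs X union_set x = [set y in X | m (r x y)].
Proof. by move=> Xx; apply/setP => y; rewrite !inE mem_union Xx; case: (y \in X). Qed.

Lemma r_refl x : x \in X -> r x x = 0%N.
Proof.
move=> /ptsP[c cc ->]; rewrite r_pts //; apply/eqP; rewrite class_eq0 ?codes_div //.
by rewrite cdiv_eq_id.
Qed.

Lemma simple_union : simple_graph X union_set.
Proof.
apply/and3P; split.
- by apply/subsetP => -[x y]; rewrite mem_union inE => /and3P[-> ->].
- apply/forallP => x; rewrite mem_union; case Xx: (x \in X) => //=.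
  by rewrite r_refl // /m /=.
apply/forallP => x; apply/forallP => y; rewrite !mem_union.
by case Xx: (x \in X); case Xy: (y \in X) => //=; rewrite rC.
Qed.

Lemma card_nbrs x : x \in X ->
  #|nbrs X union_set x| = count (fun c => m (rel_class c)) codes.
Proof.
move=> Xx; rewrite nbrs_union //.
by have := count_rel (fun i _ => m i) Xx Xx.
Qed.

Lemma card_common x y : x \in X -> y \in X ->
  #|nbrs X union_set x :&: nbrs X union_set y| =
  count (fun c => m (rel_class c) && m (rel_class (cdiv (rep (r x y)) c))) codes.
Proof.
move=> Xx Xy; rewrite -(count_rel (fun i j => m i && m j)) //.
apply: eq_card => z; rewrite !nbrs_union // !inE.
by case Xz: (z \in X) => //=; rewrite (rC Xz Xy).
Qed.

Lemma srg_unionE : strongly_regular X union_set 120 56 28 24 <-> srg_mask m.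
Proof.
have i0 := pts_in id_in_codes; split=> [[_ _ deg com]|/andP[/eqP deg /allP com]].
  apply/andP; split; first by rewrite -(card_nbrs i0) deg.
  apply/allP => k; rewrite mem_iota => /andP[k1 k7].
  have [rc rk] := rep_in k7;
    have rik : r (pts id_code) (pts (rep k)) = k by rewrite r_id.
  have ne : pts id_code != pts (rep k).
    by apply: contraTneq k1 => e; rewrite -rik e r_refl // pts_in.
  have := com _ _ i0 (pts_in rc) ne.
  by rewrite card_common ?pts_in // rik mem_union i0 pts_in // rik => ->.
split; [exact: simple_union | exact: cardX | by move=> x Xx; rewrite card_nbrs |].
move=> x y Xx Xy ne; rewrite card_common // mem_union Xx Xy /=.
have lt_r := r_lt7 Xx Xy; have r_gt0 : (0 < r x y)%N.
  rewrite lt0n; apply: contra ne => /eqP r0.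
  move: (Xx) (Xy) r0 => /ptsP[c cc ->] /ptsP[d cd ->]; rewrite r_pts // => /eqP.
  by rewrite class_eq0 ?codes_div // cdiv_eq_id // => /eqP->.
by apply/eqP/com; rewrite mem_iota r_gt0.
Qed.

Lemma srg_union : strongly_regular X union_set 120 56 28 24 <-> I = I56 \/ I = I346.
Proof.
have e : srg_mask m = (mask I == mask56) || (mask I == mask346).
  by apply/eqP/(allP check_srg); rewrite mem_bitseqs size_map size_iota.
apply: (iff_trans srg_unionE); rewrite e -mask_I56 -mask_I346.
split=> [/orP[]/eqP|[]->]; rewrite ?eqxx ?orbT //.
- by move/(mask_inj nI notin_I56); left.
- by move/(mask_inj nI notin_I346); right.
Qed.

End Unions.

End Model.

(** * The isomorphism with the complement of NO+(8,2) *)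

(** As f(u) = f(v) = 1 in characteristic 2, the form equals f(u + v), so it is nonzero exactly when
    u + v is anisotropic. *)
Lemma B_aniso u v : u \in anisotropic_points -> v \in anisotropic_points ->
  (B u v != 0) = (wt (u + v) %% 4 == 2)%N.
Proof.
move=> au av; rewrite -nonsingularE; move: au av; rewrite /B !inE.
case/andP=> /andP[Vu u0] fu /andP[/andP[Vv v0] fv].
rewrite (F2E (f u)) (F2E (f v)) fu fv memvD //= -addrA.
rewrite (_ : - true%:R - true%:R = 0 :> 'F_2) ?addr0; last exact: val_inj.
have [->|] := eqVneq (u + v) 0; last by [].
by rewrite f_wt wt_bits bits_of0.
Qed.

(* The adjacency matrix of the graph is, modulo 2, the Gram matrix of the
   anisotropic points; so it is enough to choose eight vertices with a nonsingular
   Gram submatrix, eight vectors of [V] with the same Gram matrix, and to map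
   a vertex to the combination of the vectors dual to them that is given by
   its adjacencies with the eight vertices. *)
Definition gram_vertices : seq (seq nat) :=
  [:: [:: 0; 1; 2; 3; 4; 5; 6]; [:: 0; 1; 2; 3; 4; 6; 5];
      [:: 0; 1; 2; 3; 5; 4; 6]; [:: 0; 1; 2; 3; 5; 6; 4];
      [:: 0; 1; 2; 4; 3; 5; 6]; [:: 0; 1; 2; 4; 5; 3; 6];
      [:: 0; 1; 3; 2; 4; 5; 6]; [:: 0; 1; 3; 2; 4; 6; 5]]%N.

Definition dual_vectors : seq bitseq := map block
  [:: [:: 0; 2; 3; 4; 5; 6; 7; 8]; [:: 0; 1; 2; 4; 5; 6; 7; 8]; [:: 2; 3];
      [:: 2; 3; 4; 5; 6; 8]; [:: 2; 3; 4; 8]; [:: 0; 1; 2; 3; 4; 5; 6; 8];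
      [:: 0; 1; 5; 7]; [:: 0; 1; 2; 3; 4; 5; 6; 7]]%N.

Definition adj56 (c d : seq nat) : bool := rel_class (cdiv d c) \in [:: 5; 6]%N.

Definition gram_bits (c : seq nat) : bitseq :=
  foldr (fun p l => if adj56 c p.1 then bits_add p.2 l else l)
    (nseq 9 false) (zip gram_vertices dual_vectors).

Definition gram_table : seq (seq nat * bitseq) := [seq (c, gram_bits c) | c <- codes].

Definition weight26 (l : bitseq) : bool := count id l \in [:: 2; 6]%N.

Lemma check_gram_bits : all (fun p => len9 p.2 && weight26 p.2) gram_table.
Proof. by lazy. Qed.

Lemma check_gram_uniq : uniq [seq p.2 | p <- gram_table].
Proof. by lazy. Qed.

Lemma check_gram_onto :
  all (fun l => weight26 l ==> (l \in [seq p.2 | p <- gram_table])) (bitseqs 9).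
Proof. by lazy. Qed.

Lemma check_gram_adj : all (fun p => let d := cinv 7 p.1 in
    all (fun q => (rel_class (cmul q.1 d) \in [:: 5;
      6]%N) == weight26 (bits_add p.2 q.2))
  gram_table) gram_table.
Proof. by lazy. Qed.

Lemma weight26E v : (wt v %% 4 == 2)%N = weight26 (bits_of v).
Proof.
rewrite /weight26 -wt_bits; have := wt_le9 v.
by case: (wt v) => [|[|[|[|[|[|[|[|[|[|]]]]]]]]]].
Qed.

Lemma uniq_map_inj (T1 T2 : eqType) (h : T1 -> T2) (s : seq T1) :
  uniq (map h s) -> {in s &, injective h}.
Proof.
elim: s => // a s IH /andP[na us] x y; rewrite !inE.
case/predU1P=> [->|xs] /predU1P[->|ys] // e; first by case/negP: na; rewrite e map_f.
- by case/negP: na; rewrite -e map_f.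
exact: IH.
Qed.

Section Isomorphism.

Opaque codes rel_class cdiv gram_table gram_bits weight26.

Variables (T : finType) (X : {set T}) (r : T -> T -> nat) (pts : seq nat -> T).
Hypothesis uniq_pts : uniq [seq pts c | c <- codes].
Hypothesis mem_pts : X =i [seq pts c | c <- codes].
Hypothesis r_pts : {in codes &, forall c d, r (pts c) (pts d) = rel_class (cdiv d c)}.

Definition gram_map (x : T) : vec :=
  vec_of (gram_bits (nth id_code codes (index x [seq pts c | c <- codes]))).

Lemma gram_mapE c : c \in codes -> gram_map (pts c) = vec_of (gram_bits c).
Proof.
move=> cc; have lt_c : (index c codes < size codes)%N by rewrite index_mem.
have -> : pts c = nth (pts id_code) [seq pts c | c <- codes] (index c codes).
  by rewrite (nth_map id_code) ?nth_index.
by rewrite /gram_map index_uniq ?size_map // nth_index.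
Qed.

Lemma isomorphic56 : graph_isomorphic X (union_set X r I56) anisotropic_points
  NOplus82_compl.
Proof.
exists gram_map.
have ok c : c \in codes -> size (gram_bits c) = 9%N /\ weight26 (gram_bits c).
  move=> cc; have /allP/(_ (c, gram_bits c)) := check_gram_bits.
  by case/(_ (map_f _ cc))/andP => /eqP.
have aniso c : c \in codes -> vec_of (gram_bits c) \in anisotropic_points.
  by case/ok => sz w; rewrite nonsingularE weight26E vec_ofK.
have inX x : x \in X -> exists2 c, c \in codes & x = pts c by rewrite mem_pts => /mapP.
have uniq_bits : uniq [seq gram_bits c | c <- codes].
  by have := check_gram_uniq; rewrite -map_comp.
have inj := uniq_map_inj uniq_bits.
split.
- move=> x y /inX[c cc ->] /inX[d cd ->]; rewrite (gram_mapE cc) (gram_mapE cd) => e.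
  congr pts; apply: (inj _ _ cc cd); have [sc _] := ok c cc; have [sd _] := ok d cd.
  by rewrite -(vec_ofK sc) e vec_ofK.
- apply/setP => v; apply/imsetP/idP => [[x /inX[c cc ->] ->]|];
  first by rewrite (gram_mapE cc); exact: aniso.
  rewrite nonsingularE weight26E => wv.
  have vin : bits_of v \in bitseqs 9 by rewrite mem_bitseqs size_bits_of.
  have := allP check_gram_onto _ vin; rewrite wv /= -map_comp => /mapP[c cc ev].
  exists (pts c); first by rewrite mem_pts map_f.
  by rewrite (gram_mapE cc) -[v]bits_ofK ev.
move=> x y Xx Xy; move: (Xx) (Xy) => /inX[c cc ex] /inX[d cd ey].
rewrite (mem_union mem_pts r_pts notin_I56) Xx Xy ex ey (r_pts cc cd) (gram_mapE
  cc) (gram_mapE cd) mask_I56.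
have ac := aniso c cc; have ad := aniso d cd.
have [[sc _] [sd _]] := (ok c cc, ok d cd).
rewrite inE in_setX /= ac ad (B_aniso ac ad) weight26E bits_of_add (vec_ofK sc)
  (vec_ofK sd).
have := allP check_gram_adj _ (map_f (fun c => (c, gram_bits c)) cc).
move/allP/(_ _ (map_f (fun c => (c, gram_bits c)) cd)) => /eqP /= <-.
(* The target graph also demands distinct vertices; equal images come from equal codes, whose class
   is 0 and not 5 or 6. *)
rewrite -[cmul d (cinv 7 c)]/(cdiv d c) andb_idl; last first.
  apply: contraTneq => /(congr1 bits_of);
    rewrite (vec_ofK sc) (vec_ofK sd) => /(inj _ _ cc cd) ->.
  have /eqP-> : rel_class (cdiv d d) == 0%N; last by [].
  by rewrite (class_eq0 (codes_div cd cd)) cdiv_eq_id.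
have := class_lt (codes_div cc cd); move: (rel_class _) => k.
by case: k => [|[|[|[|[|[|[|]]]]]]].
Qed.

End Isomorphism.

(** * Automorphisms of the graph *)

Definition adj346 (k : nat) : bool := nth false (false :: mask346) k.

Definition common346 (k : nat) : seq (seq nat) :=
  [seq c <- codes | adj346 (rel_class c) && adj346 (rel_class (cdiv (rep k) c))].

(* Twice the number of edges between the common neighbours of two vertices in the
   [k]-th relation. *)
Definition edge_count (k : nat) : nat :=
  let s := common346 k in
  sumn [seq count (fun d => adj346 (rel_class (cdiv d c))) s | c <- s].

Lemma check_edge_count :
  [seq edge_count k | k <- iota 1 6] = [:: 306; 312; 386; 396; 328; 402]%N.
Proof. by lazy. Qed.

Definition first_nbrs : seq (seq nat) := [seq c <- codes | rel_class c == 1%N].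
Definition nbr (j : nat) : seq nat := nth id_code first_nbrs j.

Definition pattern (c : seq nat) : seq nat := [seq rel_class (cdiv c z) | z <-
  first_nbrs].
Definition patterns : seq (seq nat) := [seq pattern c | c <- codes].

Lemma size_first_nbrs : size first_nbrs = 7%N.
Proof. by lazy. Qed.

(** A spread is identified by its relations to the seven [R_1]-neighbours of the base spread. *)
Lemma check_patterns : uniq patterns.
Proof. by lazy. Qed.

(** A nontrivial permutation of the seven neighbours that fixes the first two does not rearrange the
    patterns among themselves, so no automorphism induces it. *)
Lemma check_rigid : all (fun s => (s == id_code) ||
  has (fun w => w \notin [seq cmul s w' | w' <- patterns]) patterns) codes.
Proof. by lazy. Qed.

(** The stabiliser of the base spread takes any two distinct neighbours to the first two: the tests
    say that [a] moves the affine coset of [nbr i] to that of [nbr 0], and that of [nbr j] to that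
    of [nbr 1]. *)
Lemma check_two : all (fun i => all (fun j => (i == j) ||
  has (fun a => (cdiv (cmul (nbr i) a) (nbr 0) \in affine_codes) &&
                (cdiv (cmul (nbr j) a) (nbr 1) \in affine_codes)) affine_codes)
  (iota 0 7)) (iota 0 7).
Proof. by lazy. Qed.

Lemma uniq_first_nbrs : uniq first_nbrs.
Proof. exact: filter_uniq uniq_codes. Qed.

Lemma edge_countE k : edge_count k =
  (\sum_(c <- common346 k) count (fun d =>
    adj346 (rel_class (cdiv d c))) (common346 k))%N.
Proof. by rewrite /edge_count sumnE big_map. Qed.

Lemma nbr_in j : (j < 7)%N -> nbr j \in codes /\ rel_class (nbr j) = 1%N.
Proof.
rewrite -size_first_nbrs => /(mem_nth id_code); rewrite -/(nbr j).
by rewrite mem_filter => /andP[/eqP].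
Qed.

Lemma edge_count_inj k l : (0 < k < 7)%N -> (0 < l < 7)%N ->
  edge_count k = edge_count l -> k = l.
Proof.
have e j : (0 < j < 7)%N ->
    edge_count j = nth 0%N [:: 306; 312; 386; 396; 328; 402]%N j.-1.
  case: j => // j ltj; rewrite -check_edge_count (nth_map 0%N) ?size_iota //
    nth_iota //.
move=> hk hl; rewrite !e //;
  case: k l hk hl => [|[|[|[|[|[|[|k]]]]]]] // [|[|[|[|[|[|[|l]]]]]]] //.
Qed.

Lemma nth_first_nbrs c : c \in codes -> rel_class c = 1%N ->
  exists2 j, (j < 7)%N & c = nbr j.
Proof.
move=> cc c1; have cz : c \in first_nbrs by rewrite mem_filter c1 eqxx.
by exists (index c first_nbrs); rewrite -?size_first_nbrs ?index_mem // /nbr nth_index.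
Qed.

Section Rigid.

Variables (T : finType) (X : {set T}) (gT : finGroupType) (G : {group gT}).
Variables (to : {action gT &-> T}) (r : T -> T -> nat) (o : T) (z : nat -> T).
Hypothesis act_X : forall x g, g \in G -> (to x g \in X) = (x \in X).
Hypothesis r_mono : forall x y g, g \in G -> x \in X -> y \in X ->
  r (to x g) (to y g) = r x y.
Hypothesis r_eq0 : {in X &, forall x y, (r x y == 0%N) = (x == y)}.
Hypothesis o_in : o \in X.
Hypothesis o_trans : {in X, forall x, exists2 g, g \in G & to o g = x}.
Hypothesis z_in : forall j, (j < 7)%N -> z j \in X.
Hypothesis z_inj : forall i j, (i < 7)%N -> (j < 7)%N -> z i = z j -> i = j.
Hypothesis z_nbr : forall j, (j < 7)%N -> r o (z j) = 1%N.
Hypothesis nbr_z : {in X, forall x, r o x = 1%N -> exists2 j, (j < 7)%N & x = z j}.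
Hypothesis z_trans : forall i j, (i < 7)%N -> (j < 7)%N -> i != j ->
  exists2 g, g \in G & [/\ to o g = o, to (z i) g = z 0%N & to (z j) g = z 1%N].

Definition z_pattern (x : T) : seq nat := [seq r (z j) x | j <- iota 0 7].

Hypothesis z_pattern_inj : {in X &, injective z_pattern}.
Hypothesis z_rigid : forall p, wf_code 7 [:: 0, 1 & p]%N ->
    {in X, forall x, exists2 y, y \in X & cmul [:: 0, 1 &
      p]%N (z_pattern y) = z_pattern x} ->
  [:: 0, 1 & p]%N = iota 0 7.

(** One element of [G] brings the base point back, a second one its first two neighbours. The
    remaining map permutes the seven neighbours and so rearranges patterns: it fixes the neighbours
    by [z_rigid], then all points by [z_pattern_inj]. *)
Lemma rigid (s : T -> T) : {in X, forall x, s x \in X} ->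
    {in X &, forall x y, r (s x) (s y) = r x y} ->
  exists2 g, g \in G & {in X, forall x, s x = to x g}.
Proof.
move=> sX sr.
have fixo (s1 : T -> T) : {in X, forall x, s1 x \in X} ->
    {in X &, forall x y, r (s1 x) (s1 y) = r x y} -> s1 o = o ->
    forall j, (j < 7)%N -> exists2 i, (i < 7)%N & s1 (z j) = z i.
  move=> s1X s1r s1o j j7; apply: nbr_z; first by rewrite s1X ?z_in.
  by rewrite -s1o s1r ?z_in // z_nbr.
(* Injectivity on [X] follows from the preservation of relation 0, which is equality. *)
have s_neq (s1 : T -> T) : {in X, forall x, s1 x \in X} ->
    {in X &, forall x y, r (s1 x) (s1 y) = r x y} ->
    {in X &, forall x y, s1 x = s1 y -> x = y}.
  by move=> s1X s1r x y Xx Xy /eqP; rewrite -r_eq0 ?s1X // s1r // r_eq0 // => /eqP.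
have [g1 Gg1 g1o] := o_trans (sX o o_in).
pose s1 x := to (s x) g1^-1%g.
have s1X : {in X, forall x, s1 x \in X} by move=> x Xx; rewrite act_X ?groupV ?sX.
have s1r : {in X &, forall x y, r (s1 x) (s1 y) = r x y}.
  by move=> x y Xx Xy; rewrite r_mono ?groupV ?sX // sr.
have s1o : s1 o = o by rewrite /s1 -g1o -actM mulgV act1.
have [i i7 ei] := fixo s1 s1X s1r s1o 0%N isT.
have [j j7 ej] := fixo s1 s1X s1r s1o 1%N isT.
have nij : i != j.
  apply/eqP => e; rewrite -e in ej.
  have lt07 : (0 < 7)%N by []. have lt17 : (1 < 7)%N by [].
  have := s_neq s1 s1X s1r _ _ (z_in lt07) (z_in lt17) (etrans ei (esym ej)).
  by move/(z_inj lt07 lt17).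
have [g2 Gg2 [g2o g2i g2j]] := z_trans i7 j7 nij.
pose s2 x := to (s1 x) g2.
have s2X : {in X, forall x, s2 x \in X} by move=> x Xx; rewrite act_X ?s1X.
have s2r : {in X &, forall x y, r (s2 x) (s2 y) = r x y}.
  by move=> x y Xx Xy; rewrite r_mono ?s1X // s1r.
have s2o : s2 o = o by rewrite /s2 s1o.
have s2z0 : s2 (z 0%N) = z 0%N by rewrite /s2 ei.
have s2z1 : s2 (z 1%N) = z 1%N by rewrite /s2 ej.
pose zs := [seq z k | k <- iota 0 7].
have zsE k : (k < 7)%N -> nth o zs k = z k.
  by move=> k7; rewrite (nth_map 0%N) ?size_iota // nth_iota.
have uzs : uniq zs.
  by rewrite map_inj_in_uniq ?iota_uniq // => k l; rewrite !mem_iota; apply: z_inj.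
have idx k : (k < 7)%N -> index (z k) zs = k.
  by move=> k7; rewrite -zsE // index_uniq ?size_map ?size_iota.
pose pi := [seq index (s2 (z k)) zs | k <- iota 0 7].
have npi k : (k < 7)%N -> nth 0%N pi k = index (s2 (z k)) zs.
  by move=> k7; rewrite (nth_map 0%N) ?size_iota // nth_iota.
have pi7 k : (k < 7)%N -> (nth 0%N pi k < 7)%N /\ s2 (z k) = z (nth 0%N pi k).
  by move=> k7; rewrite npi //; have [l l7 ->] := fixo s2 s2X s2r s2o k k7; rewrite idx.
have piE : pi = [:: 0, 1 & drop 2 pi]%N.
  have p0 : nth 0%N pi 0 = 0%N by rewrite npi // s2z0 idx.
  have p1 : nth 0%N pi 1 = 1%N by rewrite npi // s2z1 idx.
  have sp : size pi = 7%N by rewrite size_map size_iota.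
  move: p0 p1 sp; rewrite -/pi; move: (pi) => [|a [|b p]] //= -> -> _.
  by rewrite drop0.
have wf_pi : wf_code 7 pi.
  rewrite /wf_code size_map size_iota eqxx andTb; apply/andP; split.
    apply/(all_nthP 0%N) => k; rewrite size_map size_iota => k7.
    by case: (pi7 k k7).
  rewrite map_inj_in_uniq ?iota_uniq // => k l; rewrite !mem_iota => k7 l7 ekl.
  apply: (z_inj k7 l7); apply: (s_neq s2 s2X s2r _ _ (z_in k7) (z_in l7)).
  by have [_ ->] := pi7 k k7; have [_ ->] := pi7 l l7; rewrite !npi // ekl.
have spi : size pi = 7%N by rewrite size_map size_iota.
clearbody pi.
have pat_eq x : x \in X -> cmul pi (z_pattern (s2 x)) = z_pattern x.
  move=> Xx; apply: (@eq_from_nth _ 0%N); rewrite !size_map ?spi ?size_iota // => k k7.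
  have [pk ek] := pi7 k k7; rewrite (nth_map 0%N) ?spi //.
  rewrite !(nth_map 0%N) ?size_iota // !nth_iota // !add0n.
  by rewrite -ek s2r ?z_in.
have pi_id : pi = iota 0 7.
  rewrite piE; apply: z_rigid; rewrite -piE // => x Xx.
  by exists (s2 x); rewrite ?s2X ?pat_eq.
have s2_id x : x \in X -> s2 x = x.
  move=> Xx; apply: (z_pattern_inj (s2X x Xx) Xx); rewrite -(pat_eq x Xx) pi_id.
  by rewrite -[LHS](mkseq_nth 0%N) size_map size_iota.
exists (g2^-1 * g1)%g; first by rewrite groupM ?groupV.
by move=> x Xx; rewrite -[in RHS](s2_id x Xx) /s2 /s1 -!actM mulKVg mulVg act1.
Qed.

End Rigid.

Section Rigidity.

Opaque codes rel_class rep cdiv first_nbrs edge_count affine_codes.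

Variables (T : finType) (X : {set T}) (gT : finGroupType) (G : {group gT}).
Variables (to : {action gT &-> T}) (r : T -> T -> nat) (pts : seq nat -> T).
Hypothesis uniq_pts : uniq [seq pts c | c <- codes].
Hypothesis mem_pts : X =i [seq pts c | c <- codes].
Hypothesis r_pts : {in codes &, forall c d, r (pts c) (pts d) = rel_class (cdiv d c)}.
Hypothesis act_X : forall x g, g \in G -> (to x g \in X) = (x \in X).
Hypothesis r_mono : forall x y g, g \in G -> x \in X -> y \in X ->
  r (to x g) (to y g) = r x y.
Hypothesis r_orbital : forall x y x' y', x \in X -> y \in X -> x' \in X -> y' \in X ->
    r x y = r x' y' ->
  exists2 g, g \in G & to x g = x' /\ to y g = y'.
Hypothesis affine_move : forall a, a \in affine_codes -> exists2 g, g \in G &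
  to (pts id_code) g = pts id_code /\
  {in codes &, forall c d, cdiv (cmul c a) d \in affine_codes -> to (pts c) g = pts d}.

Let pts_in_X c (cc : c \in codes) : pts c \in X := pts_in mem_pts cc.
Let o := pts id_code.
Let oX : o \in X := pts_in_X id_in_codes.

Lemma r_eq0 x y : x \in X -> y \in X -> (r x y == 0%N) = (x == y).
Proof.
move=> /(ptsP mem_pts)[c cc ->] /(ptsP mem_pts)[d cd ->].
rewrite (r_pts cc cd) (class_eq0 (codes_div cc cd)) -[iota 0 7]/id_code
  (cdiv_eq_id cc cd).
apply/eqP/eqP => [-> //|]; exact: (uniq_map_inj uniq_pts cd cc \o esym).
Qed.

(** The number [edge_count] expressed by adjacency alone, so that its invariance under graph
    automorphisms is a change of summation variable. *)
Definition edge_sum x y : nat :=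
  (\sum_(u in X | adj346 (r x u) && adj346 (r u y))
     \sum_(v in X | [&& adj346 (r x v), adj346 (r v y) & adj346 (r u v)]) 1)%N.

Lemma mem_inj_X (s : T -> T) : injective s -> {in X, forall x, s x \in X} ->
  forall x, (s x \in X) = (x \in X).
Proof.
move=> s_inj sX x; apply/idP/idP => [sx|]; last exact: sX.
have e : s @: X = X.
  by apply/eqP; rewrite eqEcard card_imset // leqnn andbT;
    apply/subsetP => _ /imsetP[y Xy ->]; apply: sX.
by move: sx; rewrite -{1}e => /imsetP[y Xy /s_inj ->].
Qed.

Lemma edge_sum_inj (s : T -> T) : injective s -> {in X, forall x, s x \in X} ->
    {in X &, forall x y, adj346 (r (s x) (s y)) = adj346 (r x y)} ->
  {in X &, forall x y, edge_sum (s x) (s y) = edge_sum x y}.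
Proof.
move=> s_inj sX s_adj x y Xx Xy; have memX := mem_inj_X s_inj sX.
rewrite /edge_sum (reindex_inj s_inj) /=; apply: eq_big => [u|u /andP[Xu _]].
  by rewrite memX; case Xu: (u \in X) => //=; rewrite !s_adj.
rewrite memX in Xu; rewrite (reindex_inj s_inj) /=; apply: eq_bigl => v.
by rewrite memX; case Xv: (v \in X) => //=; rewrite !s_adj.
Qed.

Lemma sum_X (P : pred T) (F : T -> nat) :
  (\sum_(x in X | P x) F x = \sum_(c <- codes | P (pts c)) F (pts c))%N.
Proof.
rewrite -[RHS](big_map pts P F) -[RHS]big_filter [RHS]big_uniq ?filter_uniq //=.
by apply: eq_bigl => x; rewrite mem_filter mem_pts andbC.
Qed.

Lemma edge_sum_rep k : (k < 7)%N -> edge_sum o (pts (rep k)) = edge_count k.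
Proof.
move=> k7; have [rc _] := rep_in k7.
have ro c : c \in codes -> r o (pts c) = rel_class c by move=> cc;
  rewrite (r_id r_pts cc).
have rk c : c \in codes -> r (pts c) (pts (rep k)) = rel_class (cdiv (rep k) c).
  by move=> cc; rewrite (r_pts cc rc).
rewrite edge_countE /common346 big_filter /edge_sum sum_X.
rewrite big_seq_cond [RHS]big_seq_cond; apply: eq_big => [c|c /andP[cc _]].
  by case cc: (c \in codes) => //=; rewrite ro // rk.
rewrite sum_X sum1_count count_filter; apply: eq_in_count => d cd /=.
by rewrite ro // rk // (r_pts cc cd) andbA andbC.
Qed.

Lemma edge_sumE x y : x \in X -> y \in X -> edge_sum x y = edge_count (r x y).
Proof.
move=> Xx Xy; have r7 := r_lt7 mem_pts r_pts Xx Xy.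
have [g Gg [gx gy]] := to_rep_pts mem_pts r_pts r_orbital Xx Xy.
rewrite -{1}gx -{1}gy -(edge_sum_rep r7); have [rc _] := rep_in r7.
apply: (edge_sum_inj (act_inj to g)) => //; last exact: pts_in_X.
- by move=> z Xz; rewrite act_X.
- by move=> z t Xz Xt; rewrite r_mono.
Qed.

Lemma adj_preserving_r (s : T -> T) : injective s -> {in X, forall x, s x \in X} ->
    {in X &, forall x y, adj346 (r (s x) (s y)) = adj346 (r x y)} ->
  {in X &, forall x y, r (s x) (s y) = r x y}.
Proof.
move=> s_inj sX s_adj x y Xx Xy.
have [->|ne] := eqVneq x y.
  have /eqP -> : r (s y) (s y) == 0%N by rewrite r_eq0 ?sX.
  by apply/esym/eqP; rewrite r_eq0.
have sne : s x != s y by rewrite (inj_eq s_inj).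
have Xsx := sX x Xx; have Xsy := sX y Xy.
have rel16 u v : u \in X -> v \in X -> u != v -> (0 < r u v < 7)%N.
  by move=> Xu Xv; rewrite (r_lt7 mem_pts r_pts Xu Xv) andbT lt0n r_eq0.
apply: edge_count_inj (rel16 _ _ Xsx Xsy sne) (rel16 _ _ Xx Xy ne) _.
rewrite -(edge_sumE Xsx Xsy) -(edge_sumE Xx Xy); exact: edge_sum_inj.
Qed.

Lemma rigid_model (s : T -> T) : {in X, forall x, s x \in X} ->
    {in X &, forall x y, r (s x) (s y) = r x y} ->
  exists2 g, g \in G & {in X, forall x, s x = to x g}.
Proof.
have zX j : (j < 7)%N -> pts (nbr j) \in X by case/nbr_in => cj _; apply: pts_in_X.
have zpat c : c \in codes -> z_pattern r (fun j => pts (nbr j)) (pts c) = pattern c.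
  move=> cc; apply: (@eq_from_nth _ 0%N).
    by rewrite !size_map size_iota size_first_nbrs.
  rewrite size_map size_iota => j j7; have [cj _] := nbr_in j7.
  rewrite (nth_map 0%N) ?size_iota // nth_iota // (r_pts cj cc).
  by rewrite (nth_map id_code) ?size_first_nbrs.
apply: (@rigid _ _ _ _ _ r o (fun j => pts (nbr j))) => //.
- exact: r_eq0.
- move=> x Xx; have e : r o o = r x x by apply/eqP;
  rewrite eq_sym (eqP (_ : r o o == 0%N)) r_eq0.
  by have [g Gg [go _]] := r_orbital oX oX Xx Xx e; exists g.
- move=> i j i7 j7 e; have [[ci _] [cj _]] := (nbr_in i7, nbr_in j7).
  have /eqP := uniq_map_inj uniq_pts ci cj e.
  by rewrite nth_uniq ?size_first_nbrs ?uniq_first_nbrs // => /eqP.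
- by move=> j j7; have [cj rj] := nbr_in j7; rewrite (r_id r_pts cj).
- move=> _ /(ptsP mem_pts)[c cc ->]; rewrite (r_id r_pts cc) => rc.
  by have [j j7 ->] := nth_first_nbrs cc rc; exists j.
- move=> i j i7 j7 nij; have in7 k : (k < 7)%N -> k \in iota 0 7 by rewrite mem_iota.
  have := allP (allP check_two i (in7 i i7)) j (in7 j j7).
  rewrite (negbTE nij) orFb => /hasP[a aff /andP[a0 a1]].
  have [g Gg [go gm]] := affine_move aff.
  have [[c0 _] [c1 _]] := (nbr_in (isT : 0 < 7)%N, nbr_in (isT : 1 < 7)%N).
  have [[ci _] [cj _]] := (nbr_in i7, nbr_in j7).
  by exists g; [exact: Gg | split;
    [exact: go | exact: gm ci c0 a0 | exact: gm cj c1 a1]].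
- move=> _ _ /(ptsP mem_pts)[c cc ->] /(ptsP mem_pts)[d cd ->].
  by rewrite (zpat c cc) (zpat d cd) => /(uniq_map_inj check_patterns cc cd)->.
move=> p wp hp; have := allP check_rigid _ (codes_sup wp).
case/orP=> [/eqP //|/hasP[_ /mapP[c cc ->]]].
have [_ /(ptsP mem_pts)[d cd ->]] := hp _ (pts_in_X cc).
rewrite (zpat c cc) (zpat d cd) => e; case/negP; apply/mapP.
by exists (pattern d); [exact: map_f | rewrite e].
Qed.

Lemma automorphisms346 :
  graph_automorphisms X (union_set X r I346) = induced_perms X G to.
Proof.
have memU := mem_union mem_pts r_pts notin_I346; rewrite mask_I346 in memU.
have GN g : g \in G -> actperm to g \in 'N(X | 'P)%g.
  by move=> Gg; apply/astabsP => x; rewrite /= apermE actpermE act_X.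
apply/setP => p; apply/setIdP/imsetP => [[p_on /forall_inP p_aut]|[g Gg ->]].
  have pX : {in X, forall x, p x \in X} by move=> x Xx; rewrite (perm_closed _ p_on).
  have p_adj : {in X &, forall x y, adj346 (r (p x) (p y)) = adj346 (r x y)}.
    move=> x y Xx Xy; have /forall_inP/(_ y Xy)/eqP := p_aut x Xx.
    by rewrite !memU !pX // Xx Xy.
  have [g Gg pg] := rigid_model pX (adj_preserving_r (@perm_inj _ p) pX p_adj).
  exists g => //; apply/permP => x; case Xx: (x \in X).
    by rewrite pg // restr_permE ?GN // actpermE.
  by rewrite (out_perm p_on) ?Xx // (out_perm (restr_perm_on _ _)) ?Xx.
split; first exact: restr_perm_on.
apply/forall_inP => x Xx; apply/forall_inP => y Xy.
rewrite !restr_permE ?GN // !actpermE !memU !act_X // r_mono // eqxx //.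
Qed.

End Rigidity.

(** * Eigenvalues from structure constants *)

Lemma mulmx_tr_eq0 (K : realFieldType) m n (M : 'M[K]_(m, n)) : M *m M^T = 0 -> M = 0.
Proof.
move=> /matrixP M0; apply/matrixP => i j; have := M0 i i; rewrite !mxE => /eqP.
rewrite psumr_eq0 => [/allP/(_ j)|k _]; last by rewrite mxE -expr2 sqr_ge0.
by rewrite mem_index_enum mxE -expr2 sqrf_eq0 => /(_ isT)/eqP.
Qed.

Section StructureConstants.

Variables (K : realFieldType) (n d : nat) (A : 'I_d.+1 -> 'M[K]_n).
Variables (P Q : 'M[K]_d.+1) (N q : K)
  (c : 'I_d.+1 -> 'I_d.+1 -> 'I_d.+1 -> K) (x0 : 'I_n).

Hypothesis A_tr : forall i, (A i)^T = A i.
Hypothesis A_0 : A ord0 = 1%:M.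
Hypothesis A_sum : \sum_i A i = const_mx 1.
Hypothesis A_mul : forall i j, A i *m A j = \sum_k c i j k *: A k.
Hypothesis A_diag : forall i, A i x0 x0 = (i == ord0)%:R.
Hypothesis N_neq0 : N != 0.
Hypothesis Q_char : forall i j k, \sum_l c i l k * Q l j = P j i * Q k j.
Hypothesis Q_sum : forall i, \sum_j Q i j = (i == ord0)%:R * N.
Hypothesis Q_row0 : forall j, Q ord0 j != 0.
Hypothesis Q_col0 : forall i, Q i ord0 = q.
Hypothesis P_inj : forall j k, (forall i, P j i = P k i) -> j = k.

(** The projection onto the j-th common eigenspace, expanded in the adjacency matrices by a multiple
    [Q] of the dual eigenmatrix; [N] absorbs the scaling. *)
Let E j : 'M[K]_n := N^-1 *: \sum_l Q l j *: A l.

(** [Q_char] is this identity in coordinates: column j of [Q] is an eigenvector of multiplication by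
    [A i]. *)
Lemma mul_A_E i j : A i *m E j = P j i *: E j.
Proof.
rewrite /E -scalemxAr mulmx_sumr [RHS]scalerA [P j i * _]mulrC -[RHS]scalerA.
congr (_ *: _); rewrite (eq_bigr (fun l => \sum_k (c i l k * Q l j) *: A k)) =>
  [|l _]; last first.
  rewrite -scalemxAr A_mul scaler_sumr; apply: eq_bigr => k _.
  by rewrite scalerA mulrC.
rewrite exchange_big scaler_sumr; apply: eq_bigr => k _ /=.
by rewrite -scaler_suml Q_char scalerA.
Qed.

Lemma tr_E j : (E j)^T = E j.
Proof.
rewrite /E linearZ linear_sum /=; congr (_ *: _); apply: eq_bigr => l _.
by rewrite linearZ /= A_tr.
Qed.

Lemma mul_E_A i j : E j *m A i = P j i *: E j.
Proof. by rewrite -[LHS]trmxK trmx_mul A_tr tr_E mul_A_E linearZ /= tr_E. Qed.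

Lemma sum_E : \sum_j E j = 1%:M.
Proof.
rewrite -scaler_sumr exchange_big /=.
rewrite (eq_bigr (fun i => ((i == ord0)%:R * N) *: A i)) => [|i _]; last first.
  by rewrite -scaler_suml Q_sum.
rewrite (bigD1 ord0) //= big1 => [|i i0]; last by rewrite (negbTE i0) mul0r scale0r.
by rewrite ?eqxx mul1r addr0 A_0 scalerA mulVf // scale1r.
Qed.

(* A common eigenvector has a nonzero component in some [E k], and the scalars
   are then read off in that component. *)
Lemma eigenvalues_of_component m (v : 'M[K]_(m, n)) (a : 'I_d.+1 -> K) k :
  (forall i, v *m A i = a i *: v) -> v *m E k != 0 -> forall i, a i = P k i.
Proof.
move=> va vk i; apply/eqP; rewrite -subr_eq0; move: vk; apply: contraR => ne.
have : (a i - P k i) *: (v *m E k) = 0.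
  by rewrite scalerBl [X in X - _]scalemxAl -va -mulmxA mul_A_E -scalemxAr subrr.
by move/eqP; rewrite scaler_eq0 (negbTE ne).
Qed.

Lemma mul_E_sum m (v : 'M[K]_(m, n)) : v = \sum_k v *m E k.
Proof. by rewrite -mulmx_sumr sum_E mulmx1. Qed.

(** The rows of [E j] are common eigenvectors for row j of [P]; a nonzero component in [E k] would
    make rows j and k equal. *)
Lemma E_orthogonal j k : j != k -> E j *m E k = 0.
Proof.
move=> jk; apply/eqP; apply: contraNT jk => jk; apply/eqP/P_inj.
by apply: eigenvalues_of_component jk => i; apply: mul_E_A.
Qed.

(** Only [A ord0] contributes at the diagonal place [x0], so that entry is [Q ord0 j] divided by
    [N]. *)
Lemma E_neq0 j : E j != 0.
Proof.
apply: contraNneq (Q_row0 j) => /matrixP/(_ x0 x0); rewrite !mxE summxE.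
rewrite (bigD1 ord0) //= big1 => [|i i0]; last first.
  by rewrite mxE A_diag (negbTE i0) mulr0.
by rewrite mxE A_diag eqxx mulr1 addr0 => /eqP;
  rewrite mulf_eq0 invr_eq0 (negbTE N_neq0).
Qed.

Lemma E_0 : E ord0 = (N^-1 * q) *: const_mx 1.
Proof.
rewrite /E -scalerA; congr (_ *: _); rewrite -A_sum scaler_sumr.
by apply: eq_bigr => i _; rewrite Q_col0.
Qed.

Lemma E_0_const : (E ord0 :=: (const_mx 1 : 'rV[K]_n))%MS.
Proof.
have c0 : N^-1 * q != 0 by rewrite mulf_neq0 ?invr_eq0 // -(Q_col0 ord0).
rewrite E_0; apply: eqmx_trans (eqmx_scale _ c0) _; apply/eqmxP/andP; split.
  by apply/row_subP => i; rewrite row_const.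
by rewrite -(row_const _ x0 (1 : K)) row_sub.
Qed.

Lemma row_eigen m (v : 'M[K]_(m, n)) j :
  (v <= \bigcap_i eigenspace (A i) (P j i))%MS <-> forall i, v *m A i = P j i *: v.
Proof.
split=> [/sub_bigcapmxP h i|h]; first exact/eigenspaceP/h.
by apply/sub_bigcapmxP => i _; apply/eigenspaceP.
Qed.

Lemma eigen_comp m (v : 'M[K]_(m, n)) j :
  (forall i, v *m A i = P j i *: v) -> v = v *m E j.
Proof.
move=> vj; rewrite {1}[v]mul_E_sum (bigD1 j) //= big1 ?addr0 // => k kj.
apply/eqP; apply: contraNT kj => kj; apply/eqP/esym/P_inj.
exact: eigenvalues_of_component vj kj.
Qed.

Lemma E_eigen j : (E j :=: \bigcap_i eigenspace (A i) (P j i))%MS.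
Proof.
apply/eqmxP/andP; split; first by apply/row_eigen => i; apply: mul_E_A.
have /row_eigen/eigen_comp -> := submx_refl (\bigcap_i eigenspace (A i) (P j i))%MS.
exact: submxMl.
Qed.

Lemma eigenspace_sum i a :
  (eigenspace (A i) a :=: \sum_(j in [set j | P j i == a]) E j)%MS.
Proof.
apply/eqmxP/andP; split; last first.
  by apply/sumsmx_subP => j; rewrite inE => /eqP <-; apply/eigenspaceP/mul_E_A.
have /eigenspaceP := submx_refl (eigenspace (A i) a); set v := eigenspace _ _ => va.
rewrite [v]mul_E_sum; apply: summx_sub => k _.
have [pk|pk] := eqVneq (P k i) a.
  by apply: submx_trans (submxMl _ _) _; apply: (sumsmx_sup k); rewrite ?inE ?pk.
suff -> : v *m E k = 0 by apply: sub0mx.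
apply/eqP; apply: contraNT pk => nz.
have : (a - P k i) *: (v *m E k) = 0.
  by rewrite scalerBl [X in X - _]scalemxAl -va -mulmxA mul_A_E -scalemxAr subrr.
by move/eqP; rewrite scaler_eq0 (negbTE nz) orbF subr_eq0 eq_sym.
Qed.

Definition eigen_decomposition (P' : 'M[K]_d.+1) : Prop :=
  exists W : 'I_d.+1 -> 'M[K]_n,
    [/\ forall j, W j != 0 /\
          (W j :=: \bigcap_(i < d.+1) eigenspace (A i) (P' j i))%MS,
        (W ord0 :=: (const_mx 1 : 'rV[K]_n))%MS,
        forall j k, j != k -> W j *m (W k)^T = 0,
        (\sum_(j < d.+1) W j :=: 1%:M)%MS
      & forall i a, eigenvalue (A i) a ->
          exists J : {set 'I_d.+1},
            (eigenspace (A i) a :=: \sum_(j in J) W j)%MS].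

Lemma eigen_decomposition_perm (s : 'S_d.+1) : s ord0 = ord0 ->
  eigen_decomposition (row_perm s P).
Proof.
move=> s0; exists (fun j => E (s j)); split.
- move=> j; split; first exact: E_neq0.
  have -> : (\bigcap_i eigenspace (A i) (row_perm s P j i) =
      \bigcap_i eigenspace (A i) (P (s j) i))%MS by apply: eq_bigr => i _; rewrite mxE.
  exact: E_eigen.
- by rewrite s0; apply: E_0_const.
- by move=> j k jk; rewrite tr_E E_orthogonal // (inj_eq perm_inj).
- apply/eqmxP; rewrite submx1 /= -{1}sum_E (reindex_inj (@perm_inj _ s)) /=.
  by apply: summx_sub => j _; apply: (sumsmx_sup j).
move=> i a _; exists (s @^-1: [set j | P j i == a]).
apply: eqmx_trans (eigenspace_sum i a) _; rewrite (reindex_inj (@perm_inj _ s)) /=.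
rewrite (eq_bigl (mem (s @^-1: [set j | P j i == a]))) => [|j]; first exact: eqmx_refl.
by rewrite !inE.
Qed.

Lemma eigen_decomposition_inv (P' : 'M[K]_d.+1) : eigen_decomposition P' ->
  exists2 s : 'S_d.+1, s ord0 = ord0 & P' = row_perm s P.
Proof.
case=> W [W1 W0 W_orth _ _].
have Weig j i : W j *m A i = P' j i *: W j.
  have [_ Wj] := W1 j; have : (W j <= \bigcap_i eigenspace (A i) (P' j i))%MS by
    rewrite Wj.
  by move/sub_bigcapmxP/(_ i isT)/eigenspaceP.
have comp j : exists k, W j *m E k != 0.
  apply/existsP; apply: contraT => /existsPn h; have [/negP nz _] := W1 j; case: nz.
  by rewrite [W j]mul_E_sum big1 // => k _; apply/eqP; have := h k; rewrite negbK.
have rowP j : exists k, [forall i, P' j i == P k i].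
  have [k nz] := comp j; exists k; apply/forallP => i.
  by apply/eqP/(eigenvalues_of_component (Weig j) nz).
pose s j := xchoose (rowP j).
have sE j i : P' j i = P (s j) i by apply/eqP/(forallP (xchooseP (rowP j))).
(* Two [W] with the same row of eigenvalues are the same space; being orthogonal to itself over an
   ordered field, it is zero. *)
have s_inj : injective s.
  move=> j k e; apply/eqP; apply: contraT => jk.
  have [nz Wj] := W1 j; have [_ Wk] := W1 k.
  have /submxP[D WD] : (W j <= W k)%MS.
    rewrite Wk (eq_bigr (fun i => eigenspace (A i) (P' j i))) ?Wj //.
    by move=> i _; rewrite !sE e.
  case/negP: nz; apply/eqP/mulmx_tr_eq0.
  by rewrite {2}WD trmx_mul mulmxA W_orth // mul0mx.
exists (perm s_inj); last by apply/matrixP => j i; rewrite mxE permE sE.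
(* [W ord0] and [E ord0] both span the constant vectors, so they have the same eigenvalues. *)
rewrite permE; apply: P_inj => i; rewrite -sE.
have E0W : (E ord0 :=: W ord0)%MS by apply: eqmx_trans E_0_const (eqmx_sym W0).
have /submxP[D WD] : (E ord0 <= W ord0)%MS by rewrite E0W.
have e : P' ord0 i *: E ord0 = P ord0 i *: E ord0.
  by rewrite -mul_E_A WD -mulmxA Weig -scalemxAr.
apply/eqP; rewrite -subr_eq0; move/eqP: e; rewrite -subr_eq0 -scalerBl scaler_eq0.
by rewrite (negbTE (E_neq0 _)) orbF.
Qed.

End StructureConstants.

(** * The association scheme *)

(** Both conclusions are linear in each factor, so they extend from the spanning matrices one factor
    at a time. *)
Lemma span_algebra (K : realFieldType) n d (A : 'I_d.+1 -> 'M[K]_n) :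
    let S := <<[seq A i | i : 'I_d.+1]>>%VS in
    (forall i j, A i *m A j \in S) -> (forall i j, A i *m A j = A j *m A i) ->
  {in S &, forall M N, M *m N \in S /\ M *m N = N *m M}.
Proof.
move=> S A_mul A_comm.
have mulA i : (S <= linfun (mulmx (A i)) @^-1: S)%VS.
  by apply/span_subvP => _ /imageP[j _ ->]; rewrite -memv_preim lfunE /= A_mul.
have commA i : (S <= lker (linfun (mulmx (A i)) - linfun (mulmxr (A i))))%VS.
  apply/span_subvP => _ /imageP[j _ ->].
  by rewrite memv_ker !lfun_simp /= A_comm subrr.
move=> M N MS NS; split.
  have : (S <= linfun (mulmxr N) @^-1: S)%VS.
    apply/span_subvP => _ /imageP[i _ ->]; rewrite -memv_preim lfunE /=.
    by have := subvP (mulA i) N NS; rewrite -memv_preim lfunE.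
  by move/subvP/(_ M MS); rewrite -memv_preim lfunE.
have : (S <= lker (linfun (mulmxr N) - linfun (mulmx N)))%VS.
  apply/span_subvP => _ /imageP[i _ ->]; rewrite memv_ker !lfun_simp /=.
  by have := subvP (commA i) N NS; rewrite memv_ker !lfun_simp.
by move/subvP/(_ M MS); rewrite memv_ker !lfun_simp /= subr_eq0 => /eqP.
Qed.

Definition class_pairs : seq (seq (nat * nat)) :=
  [seq [seq (rel_class c, rel_class (cdiv (rep k) c)) | c <- codes] | k <- iota 0 7].

Definition int_number (i j k : nat) : nat :=
  count (fun p => (p.1 == i) && (p.2 == j)) (nth [::] class_pairs k).

(* Seven times the dual eigenmatrix, which is not integral. *)
Definition Q_table : seq (seq int) :=
  [:: [:: 7; 98; 245; 140; 147; 98; 105];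
      [:: 7; 28; - 35; - 80; 63; - 28; 45];
      [:: 7; 28; - 35; - 20; - 21; 56; - 15];
      [:: 7; - 42; 35; - 20; 21; 14; - 15];
      [:: 7; 28; 35; 0; - 7; - 28; - 35];
      [:: 7; - 7; - 35; 30; 7; - 7; 5];
      [:: 7; - 7; 35; - 10; - 63; - 7; 45]].

Definition P_entry (j i : nat) : int := nth 0 (nth [::] P_table j) i.
Definition Q_entry (i j : nat) : int := nth 0 (nth [::] Q_table i) j.

(** Eigenvalues are verified rather than computed: the columns of [Q_table] are common eigenvectors
    of the intersection matrices. *)
Lemma check_Q_char : all (fun i => all (fun k =>
    let row := [seq (int_number i l k)%:Z | l <- iota 0 7] in
    all (fun j => foldr (fun l s => nth 0 row l * Q_entry l j + s) 0 (iota 0 7)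
                  == P_entry j i * Q_entry k j) (iota 0 7)) (iota 0 7)) (iota 0 7).
Proof. by lazy. Qed.

(** The value 840 is 7 times 120, the factor 7 coming from the scaling of [Q_table]. *)
Lemma check_Q_sum : all (fun i =>
    foldr (fun j s => Q_entry i j + s) 0 (iota 0 7) == (if i == 0%N then 840
      else 0)) (iota 0 7).
Proof. by lazy. Qed.

Lemma check_Q_border : all (fun j =>
  (Q_entry 0 j != 0) && (Q_entry j 0 == 7)) (iota 0 7).
Proof. by lazy. Qed.

Lemma uniq_P_table : uniq P_table.
Proof. by lazy. Qed.

Lemma foldr_sum7 (F : nat -> int) :
  foldr (fun l s => F l + s) 0 (iota 0 7) = \sum_(l < 7) F l.
Proof. by rewrite -(big_mkord xpredT F) unlock. Qed.

Lemma int_numberE (i j k : nat) : (k < 7)%N -> int_number i j k =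
  count (fun c => (rel_class c == i) && (rel_class (cdiv (rep k) c) == j)) codes.
Proof.
by move=> k7; rewrite /int_number (nth_map 0%N) ?size_iota // nth_iota // count_map.
Qed.

Definition Qmx (K : realFieldType) : 'M[K]_7 := \matrix_(i, j) (Q_entry i j)%:~R.

Lemma PmxE (K : realFieldType) (j i : 'I_7) : Pmx K j i = (P_entry j i)%:~R.
Proof. by rewrite mxE. Qed.

Lemma in_iota7 (i : 'I_7) : val i \in iota 0 7.
Proof. by rewrite mem_iota ltn_ord. Qed.

Lemma Qmx_char (K : realFieldType) (i j k : 'I_7) :
  \sum_(l < 7) (int_number i l k)%:R * Qmx K l j = Pmx K j i * Qmx K k j.
Proof.
have := allP (allP (allP check_Q_char i (in_iota7 i)) k (in_iota7 k)) j (in_iota7 j).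
move/eqP; rewrite foldr_sum7 => /(congr1 (fun m : int => m%:~R : K)).
rewrite rmorph_sum rmorphM PmxE mxE => <-; apply: eq_bigr => l _.
by rewrite mxE rmorphM (nth_map 0%N) ?size_iota // nth_iota // add0n -pmulrn.
Qed.

Lemma Qmx_sum (K : realFieldType) (i : 'I_7) :
  \sum_j Qmx K i j = (i == ord0)%:R * 840%:R.
Proof.
have /eqP := allP check_Q_sum i (in_iota7 i).
rewrite foldr_sum7 => /(congr1 (fun m : int => m%:~R : K)); rewrite rmorph_sum /=.
under [in X in _ -> X]eq_bigr do rewrite mxE.
by move->; rewrite -val_eqE /=; case: (_ == _); rewrite ?mul1r ?mul0r.
Qed.

Lemma Qmx_row0 (K : realFieldType) (j : 'I_7) : Qmx K ord0 j != 0.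
Proof. by have /andP[] := allP check_Q_border j (in_iota7 j); rewrite mxE intr_eq0. Qed.

Lemma Qmx_col0 (K : realFieldType) (i : 'I_7) : Qmx K i ord0 = 7%:R.
Proof. by have /andP[_ /eqP] := allP check_Q_border i (in_iota7 i);
  rewrite mxE => ->. Qed.

Lemma Pmx_inj (K : realFieldType) (j k : 'I_7) : (forall i,
  Pmx K j i = Pmx K k i) -> j = k.
Proof.
have lt_i (i : 'I_7) : (i < size P_table)%N by apply: ltn_ord.
move=> e; apply: val_inj; apply/eqP;
  rewrite -(nth_uniq [::] (lt_i j) (lt_i k) uniq_P_table).
have s7 (l : 'I_7) : size (nth [::] P_table l) = 7%N.
  by case: l => [[|[|[|[|[|[|[|]]]]]]]].
apply/eqP/(@eq_from_nth _ 0); rewrite !s7 // => i i7.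
by have := e (Ordinal i7); rewrite !PmxE => /intr_inj.
Qed.

Section Scheme.

Opaque codes rel_class rep cdiv int_number.

Variables (K : realFieldType) (T : finType) (X : {set T}) (gT : finGroupType) (G
  : {group gT}).
Variables (to : {action gT &-> T}) (r : T -> T -> nat) (pts : seq nat -> T).
Hypothesis uniq_pts : uniq [seq pts c | c <- codes].
Hypothesis mem_pts : X =i [seq pts c | c <- codes].
Hypothesis r_pts : {in codes &, forall c d, r (pts c) (pts d) = rel_class (cdiv d c)}.
Hypothesis act_X : forall x g, g \in G -> (to x g \in X) = (x \in X).
Hypothesis r_mono : forall x y g, g \in G -> x \in X -> y \in X ->
  r (to x g) (to y g) = r x y.
Hypothesis r_orbital : forall x y x' y', x \in X -> y \in X -> x' \in X -> y' \in X ->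
    r x y = r x' y' ->
  exists2 g, g \in G & to x g = x' /\ to y g = y'.

Let A (i : 'I_7) : 'M[K]_#|X| := adjmx X K (rel_set X r i).

Lemma adjmxE i u v : A i u v = (r (enum_val u) (enum_val v) == i)%:R.
Proof. by rewrite mxE mem_rel_set !enum_valP. Qed.

Lemma adjmx_tr i : (A i)^T = A i.
Proof. by apply/matrixP => u v; rewrite mxE !adjmxE (rC mem_pts r_pts) ?enum_valP. Qed.

Lemma adjmx_0 : A ord0 = 1%:M.
Proof.
apply/matrixP => u v; rewrite adjmxE mxE (r_eq0 uniq_pts mem_pts r_pts) ?enum_valP //.
by rewrite (inj_eq enum_val_inj).
Qed.

Lemma sum_indicator (k : nat) : (k < 7)%N ->
  forall F : nat -> K, \sum_(i < 7) F i * (k == i)%:R = F k.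
Proof.
move=> k7 F; rewrite (bigD1 (Ordinal k7)) //= eqxx mulr1 big1 ?addr0 // => i ik.
have /negbTE-> : k != i by rewrite eq_sym; move: ik; rewrite -val_eqE.
by rewrite mulr0.
Qed.

Lemma adjmx_sum : \sum_i A i = const_mx 1.
Proof.
apply/matrixP => u v; rewrite summxE mxE.
rewrite -[RHS](sum_indicator (r_lt7 mem_pts r_pts (enum_valP u) (enum_valP v))
  (fun=> 1)).
by apply: eq_bigr => i _; rewrite adjmxE mul1r.
Qed.

Lemma adjmx_mul i j : A i *m A j = \sum_(k < 7) (int_number i j k)%:R *: A k.
Proof.
apply/matrixP => u v; have [Xu Xv] := (enum_valP u, enum_valP v).
have r7 := r_lt7 mem_pts r_pts Xu Xv.
transitivity ((int_number i j (r (enum_val u) (enum_val v)))%:R : K); last first.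
  rewrite summxE -[LHS](sum_indicator r7 (fun k => (int_number i j k)%:R)).
  by apply: eq_bigr => k _; rewrite [in RHS]mxE adjmxE.
rewrite (int_numberE _ _ r7).
rewrite -(count_rel uniq_pts mem_pts r_pts act_X r_mono r_orbital (fun a b =>
  (a == i) && (b == j)) Xu Xv).
rewrite mxE (eq_bigr (fun w : 'I_#|X| =>
    ((r (enum_val u) (enum_val w) == i) && (r (enum_val w) (enum_val v) == j) :
      nat)%:R)) => [|w _]; last first.
  by rewrite !adjmxE -natrM mulnb.
rewrite -natr_sum; congr (_%:R).
set q := fun z => (r (enum_val u) z == i) && (r z (enum_val v) == j).
have -> : [set z in X | q z] = [set enum_val w | w : 'I_#|X| & q (enum_val w)].
  apply/setP => z; rewrite inE; apply/andP/imsetP => [[Xz qz]|[w qw ->]].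
    by exists (enum_rank_in Xz z); rewrite ?inE ?enum_rankK_in.
  by move: qw; rewrite inE => qw; rewrite enum_valP.
rewrite card_imset; last exact: enum_val_inj.
by rewrite -[RHS]sum1_card [RHS]big_mkcond; apply: eq_bigr => w _;
  rewrite inE /q; case: (_ && _).
Qed.

Lemma adjmx_diag u i : A i u u = (i == ord0)%:R.
Proof.
have /eqP e : r (enum_val u) (enum_val u) == 0%N.
  by rewrite (r_eq0 uniq_pts mem_pts r_pts) ?enum_valP.
by rewrite adjmxE e eq_sym.
Qed.

Lemma int_number_comm i j : A i *m A j = A j *m A i.
Proof.
rewrite -[RHS]trmxK trmx_mul !adjmx_tr adjmx_mul linear_sum /=.
by apply: eq_bigr => k _; rewrite linearZ /= adjmx_tr.
Qed.

Lemma symmetric_scheme_rel : symmetric_scheme X K (rel_set X r).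
Proof.
split.
- by move=> i; apply/subsetP => -[x y]; rewrite mem_rel_set inE => /and3P[-> ->].
- exact: adjmx_tr.
- exact: adjmx_0.
- exact: adjmx_sum.
apply: (@span_algebra K #|X| 6 A) => [i j|]; last exact: int_number_comm.
rewrite adjmx_mul; apply: memv_suml => k _; apply/memvZ/memv_span.
by apply/imageP; exists k.
Qed.

Lemma eigenvalue_matrix_rel (P : 'M[K]_7) : eigenvalue_matrix X (rel_set X r) P <->
  exists2 s : 'S_7, s ord0 = ord0 & P = row_perm s (Pmx K).
Proof.
pose u0 := enum_rank_in (pts_in mem_pts id_in_codes) (pts id_code).
have N0 : 840%:R != 0 :> K by rewrite pnatr_eq0.
pose c i j k : K := (int_number i j k)%:R.
split=> [|[s s0 ->]].
  apply: (@eigen_decomposition_inv K #|X| 6 A (Pmx K) (Qmx K) 840%:R 7%:R c u0) => //.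
  - exact: adjmx_tr.
  - exact: adjmx_0.
  - exact: adjmx_sum.
  - exact: adjmx_mul.
  - exact: adjmx_diag.
  - exact: Qmx_char.
  - exact: Qmx_sum.
  - exact: Qmx_row0.
  - exact: Qmx_col0.
  - exact: Pmx_inj.
apply: (@eigen_decomposition_perm K #|X| 6 A (Pmx K) (Qmx K) 840%:R 7%:R c u0) => //.
- exact: adjmx_tr.
- exact: adjmx_0.
- exact: adjmx_sum.
- exact: adjmx_mul.
- exact: adjmx_diag.
- exact: Qmx_char.
- exact: Qmx_sum.
- exact: Qmx_row0.
- exact: Qmx_col0.
- exact: Pmx_inj.
Qed.

End Scheme.

(** * Faithfulness *)

(** The action on the last seven coordinates gives [s], and evenness of [g] decides whether the
    first two are swapped. *)
Lemma emb7_onto g : g \in Gstar -> exists s, g = emb7 s.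
Proof.
rewrite GstarE => /andP[even_g st].
pose up (i : 'I_7) : 'I_9 := lift ord0 (lift ord0 i).
have up_inj : injective up by move=> i j /lift_inj/lift_inj.
have up_notin i : up i \notin [set c1; c2] by rewrite !inE c1E c2E -!val_eqE.
have upP k : k \notin [set c1; c2] -> exists i, k = up i.
  rewrite !inE negb_or c1E c2E => /andP[k0 k1].
  case: (unliftP ord0 k) k0 k1 => [j ->|->] //= _.
  by case: (unliftP ord0 j) => [i -> _|->]; [exists i | rewrite eqxx].
have /fin_all_exists[s0 s0E] i : exists j, g (up i) = up j by apply: upP;
  rewrite stab12_set.
have s0_inj : injective s0 by move=> i j e; apply/up_inj/(@perm_inj _ g);
  rewrite !s0E e.
pose s := perm s0_inj; exists s.
have lift7_up i : lift7 s (up i) = up (s i) by rewrite /lift7 !lift_perm_lift.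
have l1 : lift7 s c1 = c1 by rewrite c1E /lift7 lift_perm_id.
have l2 : lift7 s c2 = c2 by rewrite c2E /lift7 lift_perm_lift lift_perm_id.
have c12_up i : c12 (up i) = up i.
  by have := up_notin i; rewrite !inE negb_or => /andP[n1 n2];
    rewrite /c12 tpermD // eq_sym.
have ext (h : 'S_9) : h c1 = g c1 -> h c2 = g c2 ->
  (forall i, h (up i) = up (s i)) -> g = h.
  move=> h1 h2 hup; apply/permP => k; have [|/upP[i ->]] := boolP (k \in [set c1; c2]).
    by rewrite !inE => /orP[]/eqP->.
  by rewrite hup s0E permE.
case/orP: st => /andP[/eqP g1 /eqP g2].
  have eg : g = lift7 s by apply: ext; rewrite ?l1 ?l2.
  by move: even_g; rewrite /emb7 eg odd_lift7 => /negbTE->; rewrite mulg1.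
have eg : g = (lift7 s * c12)%g.
  by apply: ext => [||i]; rewrite permM ?l1 ?l2 ?lift7_up ?c12_c1 ?c12_c2.
move: even_g; rewrite /emb7 {1}eg odd_permM odd_lift7 odd_tperm c1_neq_c2 addbT
  negbK => ->.
exact: eg.
Qed.

Lemma check_affine_two : all (fun i => all (fun j => (i == j) ||
  has (fun a => (nth 0%N a 0 == i) && (nth 0%N a 1 == j)) affine_codes) (iota 0
    7)) (iota 0 7).
Proof. by lazy. Qed.

(** Each nontrivial affine permutation has a conjugate that is not affine, so the stabilisers of the
    spreads in [X] intersect trivially. *)
Lemma check_faithful : all (fun a => (a == id_code) ||
  has (fun c => cdiv (cmul c a) c \notin affine_codes) codes) affine_codes.
Proof. by lazy. Qed.

Section Faithful.

Opaque codes rel_class affine_codes.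

Variable b : bool.
Hypothesis spread_std : spread std_spread.
Hypothesis zfix : spread_action std_spread zperm = std_spread.

Local Notation pt := (pt b).

Lemma code_id : code (1 : 'S_7)%g = id_code. Proof. exact: code1. Qed.

(** An affine [a] can be chosen to agree with s^-1 at two points. Then [a s] fixes these points and
    still represents the base spread, so it is the identity by [pt_inj]. *)
Lemma stab_affine (s : 'S_7) : pt s = pt 1%g -> code s^-1%g \in affine_codes.
Proof.
move=> es; pose i := s^-1%g (inord 0); pose j := s^-1%g (inord 1).
have nij : val i != val j.
  by rewrite val_eqE (inj_eq perm_inj) -val_eqE /= !inordK.
have := allP (allP check_affine_two i (in_iota7 i)) j (in_iota7 j).
rewrite (negbTE nij) orFb => /hasP[a aff /andP[/eqP a0 /eqP a1]].
have ca := permcK (affine_wf aff).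
have n_a (k : 'I_7) (l : 'I_7) : nth 0%N a k = l -> permc 7 a k = l.
  by move=> e; apply: val_inj; rewrite /= -nth_code ca.
have p0 : permc 7 a (inord 0) = i by apply: n_a; rewrite inordK.
have p1 : permc 7 a (inord 1) = j by apply: n_a; rewrite inordK.
have ct : code (permc 7 a * s)%g \in codes.
  by rewrite mem_codes !permM p0 p1 !permKV !eqxx.
have c1 : code (1 : 'S_7)%g \in codes by rewrite code_id id_in_codes.
have e : (permc 7 a * s = 1)%g.
  by apply: (@pt_inj b spread_std zfix _ _ ct c1); rewrite (pt_affine _ zfix).
suff -> : s^-1%g = permc 7 a by rewrite ca.
by apply/eqP; rewrite eq_sym eq_mulgV1 invgK e.
Qed.

Variable X : {set genset}.
Hypothesis orbX : X = orbit spread_action Gstar (base_spread b).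

Lemma faithful_X : [faithful Gstar, on X | spread_action].
Proof.
apply/subsetP => g /setIP[Gg /astabP fixg]; apply/set1P.
have [s es] := emb7_onto Gg.
have fix_s t : pt (t * s)%g = pt t by rewrite ptM -es fixg // (pt_X orbX).
have aff : code s^-1%g \in affine_codes by apply: stab_affine;
  rewrite -(fix_s 1%g) mul1g.
have s1 : s^-1%g = 1%g.
  apply: code_inj; rewrite code_id; apply/eqP.
  have := allP check_faithful _ aff; case/orP=> // /hasP[c cc].
  rewrite -(permcK (codes_wf cc)) /cdiv -code_inv -!code_mul; move: (permc 7 c) => t.
  case/negP; have -> : (t * s^-1 * t^-1 =
    (t * s * t^-1)^-1)%g by rewrite !invMg invgK mulgA.
  by apply: stab_affine; rewrite ptM fix_s -ptM mulgV.
by rewrite es -[s]invgK s1 invg1 emb7_1.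
Qed.

End Faithful.

Lemma RelE (X : {set genset}) : Rel X = rel_set X ridx.
Proof.
by apply: boolp.funext => i; apply/setP => -[x y]; rewrite mem_Rel mem_rel_set.
Qed.

Lemma Pmx_mul (K : realFieldType) (s t : seq int) :
    all (fun i => foldr (fun l a =>
      P_entry i l * nth 0 s l + a) 0 (iota 0 7) == nth 0 t i) (iota 0 7) ->
  Pmx K *m col7 K s = col7 K t.
Proof.
move=> /allP st; apply/matrixP => i j;
  rewrite !mxE -(eqP (st _ (in_iota7 i))) foldr_sum7.
rewrite rmorph_sum; apply: eq_bigr => l _.
by rewrite PmxE mxE rmorphM.
Qed.

Theorem theorem3p3 (K : realType) (Y : {set {vspace vec}}) (X : {set genset}) :
  Y \in systems ->
  X \in [set orbit spread_action Gstar S | S in spreads_in Y] ->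
  #|X| = 120%N ->
  [/\ [/\ generously_transitive X Gstar spread_action,
          injective (Rel X)
        & [set Rel X i | i : 'I_7] = orbitals X Gstar spread_action],
      symmetric_scheme X K (Rel X),
      forall P : 'M[K]_7, eigenvalue_matrix X (Rel X) P <->
        exists2 s : 'S_7, s ord0 = ord0 & P = row_perm s (Pmx K),
      [/\ forall I : {set 'I_7}, ord0 \notin I ->
            (strongly_regular X (union_Rel X I) 120 56 28 24 <->
             I = I56 \/ I = I346),
          Pmx K *m col7 K [:: 0; 0; 0; 0; 0; 1; 1]
            = col7 K [:: 56; - 4; - 4; 8; - 4; - 4; 8]
        & Pmx K *m col7 K [:: 0; 0; 0; 1; 1; 0; 1]
            = col7 K [:: 56; - 4; 8; - 4; - 4; - 4; - 4]]
    & [/\ graph_isomorphic X (union_Rel X I56)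
            anisotropic_points NOplus82_compl,
          [faithful Gstar, on X | spread_action]
        & graph_automorphisms X (union_Rel X I346)
            = induced_perms X Gstar spread_action]].
Proof.
move=> _ hX cX; have [b [spS zS orbX]] := orbit_std hX cX.
pose pts c := pt b (permc 7 c).
have codeK' c : c \in codes -> code (permc 7 c) = c by move/codes_wf/permcK.
have uniq_pts : uniq [seq pts c | c <- codes] := uniq_points b spS zS.
have mem_pts : X =i [seq pts c | c <- codes] := mem_points spS zS orbX cX.
have r_pts : {in codes &, forall c d, ridx (pts c) (pts d) = rel_class (cdiv d c)}.
  by move=> c d cc cd; rewrite (ridx_pt b spS zS) !codeK'.
have actX : forall x g, g \in Gstar -> (spread_action x g \in X) = (x \in X).
  by move=> x g; apply: act_X orbX x g.
have r_mono := ridx_mono spS zS orbX cX.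
have r_orb := ridx_orbital spS zS orbX cX.
(* If c a d^-1 is affine, then c a and d lie in one affine coset and represent the same spread. *)
have aff a : a \in affine_codes -> exists2 g, g \in Gstar &
    spread_action (pts id_code) g = pts id_code /\
    {in codes &, forall c d, cdiv (cmul c a) d \in affine_codes ->
       spread_action (pts c) g = pts d}.
  move=> aa; have ca := permcK (affine_wf aa).
  exists (emb7 (permc 7 a)); first exact: emb7_Gstar.
  rewrite /pts -code_id codeK; split.
    by rewrite -ptM mul1g -[permc 7 a]mulg1 pt_affine.
  move=> c d cc cd acd; rewrite -ptM.
  rewrite -[X in pt b X](mulgKV (permc 7 d)) -[X in pt b (X * _)]codeK.
  by rewrite !code_mul code_inv ca !codeK' // pt_affine.
have U I : union_Rel X I = union_set X ridx I by rewrite /union_Rel RelE.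
rewrite RelE; split.
- split; first exact: generously_transitive_X mem_pts r_pts r_orb.
    exact: rel_set_inj mem_pts r_pts.
  exact: rel_set_orbitals mem_pts r_pts actX r_mono r_orb.
- exact: symmetric_scheme_rel uniq_pts mem_pts r_pts actX r_mono r_orb.
- exact: eigenvalue_matrix_rel uniq_pts mem_pts r_pts actX r_mono r_orb.
- split.
  + move=> I nI; rewrite U.
    exact: srg_union uniq_pts mem_pts r_pts actX r_mono r_orb I nI.
  + by apply: Pmx_mul; lazy.
  + by apply: Pmx_mul; lazy.
split; rewrite ?U.
- exact: isomorphic56 uniq_pts mem_pts r_pts.
- exact: (@faithful_X b spS zS X orbX).
exact: automorphisms346 uniq_pts mem_pts r_pts actX r_mono r_orb aff.
Qed.
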